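(* For $k\ge1$ let $P_0(k)$ be the proportion of integers $n\in[0,k^2+k)$ for which $N(n,k)=0$. Then $P_0(k)\to 3/\pi^2$ as $k\to\infty$.
   Context: For $n>k\ge1$, $N(n,k)$ is the nullity of the $n\times n$ skew-symmetric Toeplitz matrix $A(n,k)$ whose first $k$ superdiagonals have all entries $1$ and whose remaining superdiagonals have all entries $0$. This nullity depends only on $n\bmod (k^2+k)$, and $N(n,k)$ is defined for every integer $n$ as $N(n',k)$ for any $n'>k$ with $n'\equiv n\pmod{k^2+k}$. *)

(* Defs.v *)
From HB Require Import structures.
From mathcomp Require Import all_boot all_order all_algebra.
From mathcomp Require Import all_classical all_reals all_analysis.
Set Implicit Arguments. Unset Strict Implicit. Unset Printing Implicit Defensive.
Import Order.TTheory GRing.Theory Num.Theory.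
Local Open Scope ring_scope.

Definition Amat (n k : nat) : 'M[rat]_n :=
  \matrix_(i < n, j < n)
    if ((i < j)%N && (j <= i + k)%N) then 1
    else if ((j < i)%N && (i <= j + k)%N) then -1 else 0.

Definition nullity (n k : nat) : nat := (n - \rank (Amat n k))%N.

(* N(n,k) for a residue n in [0, k^2+k): the nullity of A(n',k) for the
   representative n' = n + (k^2+k) > k of the residue class of n. *)
Definition Nres (n k : nat) : nat := nullity (n + (k ^ 2 + k)) k.

Definition P0 (R : realType) (k : nat) : R :=
  (count (fun n => Nres n k == 0%N) (iota 0 (k ^ 2 + k)))%:R / (k ^ 2 + k)%:R.

(* Main.v *)
(** The symbol of the band matrix is [x^-k (x^k - 1)(x^(k+1) - 1) / (x - 1)], so a kernel
    vector is a function on the [k + 1] points of a circle that is compatible with a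
    rotation of [k] points and a rotation of [k + 1] points; the matrix is regular iff
    the resulting permutation is a single cycle. For a real [x] outside the Farey
    fractions of order [k], the cyclic order of [0, x, 2x, ..., kx] modulo 1 (a Sos
    permutation) exhibits such a single cycle for [n = 2 (floor x + ... + floor (kx))].
    When [x] crosses a fraction [p / q], this [n] jumps by [2 (k %/ q)], and for all [n]
    strictly inside the jump the cycle splits. Hence the regular [n] modulo [k^2 + k]
    correspond to the Farey fractions in [[0, 1[], and their number is the sum of
    [totient q] over [q <= k].

    The asymptotics of this sum follows from [sum_d Phi (k %/ d) = k (k + 1) / 2] by a
    contraction argument, together with [zeta(2) = pi^2 / 6], obtained by iterating
    [4 / sin^2 x = 1 / sin^2 (x / 2) + 1 / cos^2 (x / 2)]. *)

Require Import Defs.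
From HB Require Import structures.
From mathcomp Require Import all_boot all_order all_algebra cyclic.
From mathcomp Require Import all_classical all_reals all_analysis.
From mathcomp Require Import zify ring lra.
Set Implicit Arguments. Unset Strict Implicit. Unset Printing Implicit Defensive.
Import Order.TTheory GRing.Theory Num.Theory numFieldNormedType.Exports.

(** * Congruences and the linking problem *)

Definition eqmod (d a b : nat) := a = b %[mod d].

Lemma eqmod_sym d a b : eqmod d a b -> eqmod d b a.
Proof. by []. Qed.

(** Subtraction-free linear combination: three congruences are added and the common summand [c] is
    cancelled, which leaves side equations for [lia]. *)
Lemma eqmod_cancel3 d a1 b1 a2 b2 a3 b3 x y c :
  eqmod d a1 b1 -> eqmod d a2 b2 -> eqmod d a3 b3 ->
  x + c = a1 + a2 + a3 -> y + c = b1 + b2 + b3 -> eqmod d x y.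
Proof.
move=> e1 e2 e3 ex ey; apply/eqP; rewrite -(eqn_modDr c) ex ey; apply/eqP.
have D a b a' b' : eqmod d a b -> eqmod d a' b' -> eqmod d (a + a') (b + b').
  by rewrite /eqmod -modnDm => -> ->; rewrite modnDm.
by apply: (D _ _ _ _ (D _ _ _ _ e1 e2) e3).
Qed.

Lemma eqmod_cases d a b : eqmod d a b -> a < d -> b < d.*2 -> b = a \/ b = a + d.
Proof.
move=> e aD bD; move: e; rewrite /eqmod (modn_small aD); case: (ltnP b d) => bD'.
  by rewrite modn_small // => ->; left.
rewrite -{1}(subnK bD') modnDr modn_small; lia.
Qed.

Lemma eqmod_small d a b : eqmod d a b -> b < d -> a %% d = b.
Proof. by move=> ->; exact: modn_small. Qed.

(* Kernel vectors of [Amat n k] correspond to pairs of polynomials [p, q] of degree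
   [< k] such that [(X^k - 1)(1 + ... + X^k)] divides [p + X^(n+k) q]; here
   [u m] is [- p_(m-1)] and [w m] is [q_(k-m)], with the convention that the index
   [0] carries the vanishing coefficient of degree [k]. Divisibility by [X^k.+1 - 1]
   and by [X^k - 1] become the two compatibility conditions. *)
Definition linked (n k : nat) (u w : nat -> rat) :=
  [/\ u 0 = 0%R, w 0 = 0%R,
      forall m m', m <= k -> m' <= k -> eqmod k.+1 (m + m' + 1) n -> u m = w m'
    & forall m m', 0 < m <= k -> 0 < m' <= k -> eqmod k (m + m') (n + 1) ->
        u m = w m'].

(** Asking for [w] is enough: modulo [k.+1] each [u m] with [m <= k] equals some [w m']. *)
Definition unlinkable (n k : nat) :=
  forall u w, linked n k u w -> forall m, m <= k -> w m = 0%R.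

(** * Solving the compatibility conditions along a single orbit *)

Section Orbit.

Variables (k s : nat) (K : nat -> nat).
Hypothesis K0 : K 0 = 0.
Hypothesis Kle : forall j, K j <= k.
Hypothesis Kinj : forall i j, i <= k -> j <= k -> K i = K j -> i = j.
Hypothesis KA : forall i j, i + j = k -> eqmod k.+1 (K i + K j + 1) s.
Hypothesis KB : forall i j, 0 < i -> 0 < j -> i + j = k.+1 ->
  eqmod k (K i + K j) (s + 1).

(** [K] lists the points [0, ..., k] in the order in which the cycle visits them; this is its
    inverse, total on these points because [K] is injective. *)
Definition orbit_time m := index m (map K (iota 0 k.+1)).

Lemma mem_orbit_map m : m <= k -> m \in map K (iota 0 k.+1).
Proof.
move=> mk.
have [|||_ ->] := @uniq_min_size _ (map K (iota 0 k.+1)) (iota 0 k.+1).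
- rewrite map_inj_in_uniq ?iota_uniq // => i j; rewrite !mem_iota => hi hj.
  by apply: Kinj; lia.
- by move=> _ /mapP[j _ ->]; rewrite mem_iota /= ltnS Kle.
- by rewrite size_map.
by rewrite mem_iota.
Qed.

Lemma orbit_time_le m : m <= k -> orbit_time m <= k.
Proof. by move=> /mem_orbit_map; rewrite -index_mem size_map size_iota ltnS. Qed.

Lemma orbit_timeK m : m <= k -> K (orbit_time m) = m.
Proof.
move=> mk; have := nth_index 0 (mem_orbit_map mk).
by rewrite -/(orbit_time m) (nth_map 0) ?size_iota ?nth_iota // ltnS orbit_time_le.
Qed.

Lemma Korbit_time j : j <= k -> orbit_time (K j) = j.
Proof.
by move=> jk; apply: Kinj; rewrite ?orbit_timeK ?orbit_time_le ?Kle.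
Qed.

Lemma K_gt0 j : 0 < j <= k -> 0 < K j.
Proof.
move=> hj; rewrite lt0n; apply/eqP => h.
by have := Kinj (i := j) (j := 0); rewrite K0 h; lia.
Qed.

Lemma orbit_time_gt0 m : 0 < m <= k -> 0 < orbit_time m.
Proof.
move=> hm; have := @orbit_timeK m ltac:(lia).
by case: orbit_time => //; rewrite K0; lia.
Qed.

(* The two conditions alternately link [u (K 0)], [w (K k)], [u (K 1)],
   [w (K k.-1)], ..., so that everything equals [u 0 = 0]. *)
Lemma orbit_unlinkable n : eqmod k.+1 n s -> eqmod k n s -> unlinkable n k.
Proof.
move=> nA nB u w [u0 w0 uwA uwB].
have uw i : i <= k -> u (K i) = 0%R /\ w (K (k - i)) = 0%R.
  elim: i => [|i IH] ik.
    split; first by rewrite K0.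
    rewrite -(uwA (K 0)) ?Kle ?K0 //.
    by have := KA (i := 0) (j := k - 0); rewrite /eqmod K0 nA; apply; lia.
  have [_ wi] := IH (ltnW ik).
  have ui : u (K i.+1) = 0%R.
    rewrite (uwB _ (K (k - i))) ?K_gt0 ?Kle ?subn_gt0 ?ik ?leq_subr //.
    apply: eqmod_cancel3 (KB (i := i.+1) (j := k - i) _ _ _)
      (eqmod_sym nB) (erefl : eqmod k 0 0) _ _ => //.
    - lia.
    - lia.
    - by instantiate (1 := s); lia.
    - lia.
  split=> //; rewrite -(uwA (K i.+1)) ?Kle //.
  by rewrite /eqmod nA; apply: KA; lia.
move=> m mk; have h := orbit_time_le mk.
have [_] := uw (k - orbit_time m) (leq_subr _ _).
by rewrite subKn // orbit_timeK.
Qed.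

(* Moving [n] by [e] relinks only the [e + 1] points [K 0, K d, ..., K (e d)], which
   are neighbours on the circle; the orbit then splits, and the indicator of the
   times [0, ..., d.-1] is a solution. *)
Section Singular.

Variables (n d e : nat).
Hypotheses (d_gt0 : 0 < d) (e_gt0 : 0 < e) (ed_le : e * d <= k).

(** Times are reversed because the condition modulo [k.+1] pairs time [i] of [u] with time [k - i]
    of [w]. *)
Let w m := ((k - orbit_time m < d)%N%:R : rat)%R.

Let d_le : d <= k. Proof. nia. Qed.
Let e_le : e <= k. Proof. nia. Qed.

Let w0 : w 0 = 0%R.
Proof.
rewrite /w -K0 Korbit_time // subn0 ltnNge d_le //.
Qed.

Let wk : w (K k) <> 0%R.
Proof. by rewrite /w Korbit_time // subnn d_gt0. Qed.

Let linkA m' : m' <= k -> exists i, [/\ i <= k, w m' = ((i < d)%N%:R)%R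
  & eqmod k.+1 (K i + m' + 1) s].
Proof.
move=> mk; have h := orbit_time_le mk; exists (k - orbit_time m'); split=> //.
  lia.
by have := KA (i := k - orbit_time m') (j := orbit_time m') ltac:(lia); rewrite orbit_timeK.
Qed.

(** Modulo [k] paired times add up to [k.+1], so the bound [i < d] of [linkA] becomes [i <= d]. The
    two differ only at [i = d], where the relinking must intervene. *)
Let linkB m' : 0 < m' <= k -> exists i, [/\ 0 < i <= k, w m' = ((i <= d)%N%:R)%R
  & eqmod k (K i + m') (s + 1)].
Proof.
move=> mk; have h := @orbit_time_le m' ltac:(lia); have h0 := orbit_time_gt0 mk.
exists (k.+1 - orbit_time m'); split; first lia.
  by rewrite /w; congr (_%:R)%R; lia.
have := KB (i := k.+1 - orbit_time m') (j := orbit_time m') ltac:(lia) h0 ltac:(lia).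
by rewrite orbit_timeK //; lia.
Qed.

Lemma orbit_singular_lower : (forall m, m <= e -> K (m * d) = m) ->
  eqmod k.+1 (n + e) s -> eqmod k (n + e) s -> ~ unlinkable n k.
Proof.
move=> Kd nA nB.
have Td m : m <= e -> orbit_time m = m * d.
  by move=> me; rewrite -{1}(Kd m me) Korbit_time // (leq_trans _ ed_le) // leq_mul2r me orbT.
pose u m := ((orbit_time ((m + e) %% k.+1) < d)%N%:R : rat)%R.
move=> /(_ u w) h; apply: wk; apply: h (Kle _); split=> //.
- rewrite /u add0n modn_small ?ltnS // Td // ltnNge.
  by rewrite leq_pmull.
- move=> m m' mk mk' hm; have [i [ik -> hi]] := linkA mk'.
  have {}hm : eqmod k.+1 (m + e) (K i).
    by apply: (eqmod_cancel3 (c := m' + 1 + s + n)) hm (eqmod_sym hi) nA _ _; lia.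
  by rewrite /u (eqmod_small hm) ?ltnS ?Kle // Korbit_time.
- move=> m m' mk mk' hm; have [i [ik -> hi]] := linkB mk'.
  have Ki0 := K_gt0 ik; have Kik := Kle i.
  have {}hm : eqmod k (K i).-1 (m + e).-1.
    apply: (eqmod_cancel3 (c := m' + 1 + s + n + 1)) (eqmod_sym hm) hi (eqmod_sym nB) _ _; lia.
  case: (eqmod_cases hm) => [||h|h]; try lia.
    have hi' : orbit_time (m + e) = i by rewrite (_ : m + e = K i) ?Korbit_time //; lia.
    rewrite /u modn_small ?hi'; last lia.
    (* The only conflict would be [i = d], but then [K i = 1], while here [K i = m + e >= 2]. *)
    have : i <> d.
      by move=> id; have := Kd 1 e_gt0; rewrite mul1n -id; lia.
    by move=> ?; congr (_%:R)%R; lia.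
  (* Wrap-around: [K i <= e], the shifted point is [K i - 1], and both indicators amount to
     [K i = 1]. *)
  have hi' : i = (K i) * d.
    by rewrite -Td; [rewrite Korbit_time //|]; lia.
  rewrite /u (_ : m + e = (K i).-1 + k.+1); last lia.
  rewrite modnDr modn_small; last lia.
  rewrite Td; last lia.
  rewrite {2}hi'; congr (_%:R)%R.
  case: (K i) Ki0 => // [[|c]] _ /=; first by rewrite mul0n mul1n d_gt0 leqnn.
  by rewrite ltnNge leq_pmull // leqNgt -{1}[d]mul1n ltn_pmul2r.
Qed.

Lemma orbit_singular_upper :
  (forall m, 0 < m -> m <= e -> K (m * d) = k.+1 - m) ->
  eqmod k.+1 n (s + e) -> eqmod k n (s + e) -> ~ unlinkable n k.
Proof.
move=> Kd nA nB.
have Td m : 0 < m -> m <= e -> orbit_time (k.+1 - m) = m * d.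
  by move=> m0 me; rewrite -(Kd m m0 me) Korbit_time // (leq_trans _ ed_le) // leq_mul2r me orbT.
pose u m := ((orbit_time ((m + (k.+1 - e)) %% k.+1) < d)%N%:R : rat)%R.
move=> /(_ u w) h; apply: wk; apply: h (Kle _); split=> //.
- rewrite /u add0n modn_small ?Td //; last lia.
  by rewrite ltnNge leq_pmull.
- move=> m m' mk mk' hm; have [i [ik -> hi]] := linkA mk'.
  have {}hm : eqmod k.+1 (m + (k.+1 - e)) (K i).
    have h : eqmod k.+1 m (K i + e).
      by apply: (eqmod_cancel3 (c := m' + 1 + s + n)) hm (eqmod_sym hi) nA _ _; lia.
    by rewrite /eqmod -modnDml h modnDml -addnA subnKC ?modnDr; lia.
  by rewrite /u (eqmod_small hm) ?ltnS ?Kle // Korbit_time.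
- move=> m m' mk mk' hm; have [i [ik -> hi]] := linkB mk'.
  have Ki0 := K_gt0 ik; have Kik := Kle i.
  have {}hm : eqmod k m.-1 (K i + e).-1.
    apply: (eqmod_cancel3 (c := m' + 1 + s + n + 1)) hm (eqmod_sym hi) nB _ _; lia.
  case: (eqmod_cases hm) => [||h|h]; try lia.
    have hi' : orbit_time (m - e) = i by rewrite (_ : m - e = K i) ?Korbit_time //; lia.
    rewrite /u (_ : m + (k.+1 - e) = m - e + k.+1); last lia.
    rewrite modnDr modn_small ?hi'; last lia.
    have : i <> d.
      by move=> id; have := Kd 1 isT e_gt0; rewrite mul1n -id; lia.
    by move=> ?; congr (_%:R)%R; lia.
  have hi' : i = (e - m).+1 * d.
    rewrite -Td; [|lia|lia]; rewrite (_ : k.+1 - (e - m).+1 = K i); last lia.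
    by rewrite Korbit_time //; lia.
  (* For [e = m] the shifted point is [k.+1], which wraps to [K 0]; otherwise it is
     [K ((e - m) * d)]. *)
  have -> : u m = (((e - m) * d < d)%N%:R)%R.
    rewrite /u; congr ((_ < _)%N%:R)%R; case: (posnP (e - m)) => em.
      rewrite em mul0n (_ : m + _ = 0 + k.+1); last lia.
      by rewrite modnDr mod0n -{1}K0 Korbit_time.
    by rewrite modn_small -?Td; [congr orbit_time| | |]; lia.
  rewrite hi'; congr (_%:R)%R.
  case: (e - m) => [|c]; first by rewrite mul0n mul1n d_gt0 leqnn.
  by rewrite ltnNge leq_pmull // leqNgt -{1}[d]mul1n ltn_pmul2r.
Qed.

End Singular.

End Orbit.

(** * The order of the multiples of [P / Q] on the circle *)

Section SosPermutation.

Variables (k P Q : nat).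
Hypothesis Q_gt0 : 0 < Q.
Hypothesis Qndvd : forall l, 0 < l <= k -> ~~ (Q %| l * P).

Definition rot_res l := (l * P) %% Q.
Definition rot_floor l := (l * P) %/ Q.
(** The Sos permutation of [P / Q]: the place of the fractional part of [j * P / Q] on the circle,
    counted from the point [0]. *)
Definition rot_rank j := count (fun i => rot_res i <= rot_res j) (iota 1 k).
Definition rot_floor_sum j := \sum_(0 <= l < j) rot_floor l.

Lemma rot_res_inj i j : i <= k -> j <= k -> rot_res i = rot_res j -> i = j.
Proof.
wlog le_ij : i j / i <= j => [hw|] ik jk e.
  case: (leqP i j) => [/hw|/ltnW/hw]; first exact.
  by move=> h; apply/esym/h.
apply/eqP; rewrite eqn_leq le_ij /= leqNgt; apply/negP => lt_ij.
have /negP[] := @Qndvd (j - i) ltac:(lia).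
by rewrite mulnBl -eqn_mod_dvd ?leq_mul2r ?le_ij ?orbT //; apply/eqP.
Qed.

Lemma rot_rank0 : rot_rank 0 = 0.
Proof.
apply/eqP; rewrite -leqn0 leqNgt -has_count; apply/hasPn => i.
rewrite mem_iota => hi; rewrite /rot_res mul0n mod0n leqn0.
by apply: Qndvd; lia.
Qed.

Lemma rot_rank_le j : rot_rank j <= k.
Proof. by rewrite (leq_trans (count_size _ _)) ?size_iota. Qed.

Lemma rot_rank_lt i j : j <= k -> rot_res i < rot_res j -> rot_rank i < rot_rank j.
Proof.
move=> jk lt_ij; have j0 : 0 < j.
  by case: j lt_ij {jk} => //; rewrite {2}/rot_res mul0n mod0n.
have -> : rot_rank j = count (fun l => rot_res l <= rot_res i) (iota 1 k) +
   count (fun l => rot_res i < rot_res l <= rot_res j) (iota 1 k).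
  rewrite -count_predUI [X in _ + X](_ : _ = 0) ?addn0.
    by apply: eq_count => l /=; lia.
  by apply/eqP; rewrite -leqn0 leqNgt -has_count; apply/hasPn => l _ /=; lia.
rewrite -/(rot_rank i) -addn1 leq_add2l -has_count.
by apply/hasP; exists j; rewrite ?mem_iota ?lt_ij ?leqnn //; lia.
Qed.

Lemma rot_rank_inj i j : i <= k -> j <= k -> rot_rank i = rot_rank j -> i = j.
Proof.
move=> ik jk e; apply: rot_res_inj => //.
by case: (ltngtP (rot_res i) (rot_res j)) => // h;
  [have := rot_rank_lt jk h | have := rot_rank_lt ik h]; rewrite e ltnn.
Qed.

(** The comparison fails exactly when adding [i * P] and [(j - i) * P] produces a carry modulo
    [Q]. *)
Lemma rot_res_le_lo i j : i <= j ->
  (rot_res i <= rot_res j) + rot_floor j = rot_floor i + rot_floor (j - i) + 1.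
Proof.
move=> ij; rewrite /rot_res /rot_floor mulnBl.
have le_ij : i * P <= j * P by rewrite leq_mul2r ij orbT.
have := divnD (i * P) (j * P - i * P) Q_gt0.
have := modnD (i * P) (j * P - i * P) Q_gt0.
rewrite subnKC //.
have := ltn_pmod (i * P) Q_gt0; have := ltn_pmod (j * P - i * P) Q_gt0.
case: leqP; rewrite ?mul1n ?mul0n; lia.
Qed.

Lemma rot_res_le_hi i j : j < i <= k ->
  (rot_res i <= rot_res j) + rot_floor j + rot_floor (i - j) = rot_floor i.
Proof.
move=> /andP[ji ik]; have := rot_res_le_lo (ltnW ji).
have : rot_res i <> rot_res j by move=> /rot_res_inj; lia.
lia.
Qed.

(** Sum of the carry identities over [1 <= i <= k], split at [j]. The partial floor sums have
    opposite signs, so they cancel, up to single floors, when complementary indices are added in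
    [rot_rankA] and [rot_rankB]. *)
Lemma rot_rankE j : j <= k ->
  rot_rank j + k * rot_floor j + rot_floor_sum (k - j).+1 =
  j + rot_floor_sum k.+1 + rot_floor_sum j.
Proof.
move=> jk.
have -> : rot_rank j = \sum_(1 <= i < k.+1) (rot_res i <= rot_res j).
  by rewrite /rot_rank -sum1_count big_mkcond /index_iota subn1.
have f0 : rot_floor 0 = 0 by rewrite /rot_floor mul0n div0n.
have fs n : rot_floor_sum n.+1 = \sum_(1 <= l < n.+1) rot_floor l.
  by rewrite /rot_floor_sum big_ltn // f0.
have sm n c : \sum_(1 <= l < n.+1) c = n * c.
  by rewrite sum_nat_const_nat subn1.
rewrite -(sm k (rot_floor j)) !fs -big_split /=.
rewrite (@big_cat_nat _ _ _ j.+1) //= [in RHS](@big_cat_nat _ _ _ j.+1) //=.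
have -> : \sum_(1 <= i < j.+1) ((rot_res i <= rot_res j) + rot_floor j) =
    \sum_(1 <= i < j.+1) rot_floor i + rot_floor_sum j + j.
  have -> : rot_floor_sum j = \sum_(1 <= i < j.+1) rot_floor (j - i).
    by rewrite /rot_floor_sum big_nat_rev /= big_add1 add0n.
  transitivity (\sum_(1 <= i < j.+1) (rot_floor i + rot_floor (j - i) + 1)).
    by apply: eq_big_nat => i hi; rewrite rot_res_le_lo //; lia.
  by rewrite !big_split /= sm muln1.
have <- : \sum_(j.+1 <= i < k.+1) ((rot_res i <= rot_res j) + rot_floor j) +
   \sum_(1 <= l < (k - j).+1) rot_floor l = \sum_(j.+1 <= i < k.+1) rot_floor i.
  have -> : \sum_(1 <= l < (k - j).+1) rot_floor l = \sum_(j.+1 <= i < k.+1) rot_floor (i - j).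
    rewrite -[j.+1]add1n big_addn -subSn //.
    by apply: eq_bigr => i _; rewrite addnK.
  rewrite -big_split /=; apply: eq_big_nat => i hi.
  by rewrite rot_res_le_hi //; lia.
lia.
Qed.

Lemma rot_floor_sumS j : rot_floor_sum j.+1 = rot_floor_sum j + rot_floor j.
Proof. by rewrite /rot_floor_sum big_nat_recr. Qed.

Lemma rot_rankA i j : i + j = k ->
  rot_rank i + rot_rank j + k.+1 * (rot_floor i + rot_floor j) = k + 2 * rot_floor_sum k.+1.
Proof.
move=> ij; have := @rot_rankE i ltac:(lia); have := @rot_rankE j ltac:(lia).
have [-> ->] : k - i = j /\ k - j = i by lia.
rewrite !rot_floor_sumS.
rewrite mulSn mulnDr; lia.
Qed.

Lemma rot_rankB i j : 0 < i -> 0 < j -> i + j = k.+1 ->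
  rot_rank i + rot_rank j + k * (rot_floor i + rot_floor j) = k + 1 + 2 * rot_floor_sum k.+1.
Proof.
move=> i0 j0 ij; have := @rot_rankE i ltac:(lia); have := @rot_rankE j ltac:(lia).
have [-> ->] : (k - i).+1 = j /\ (k - j).+1 = i by lia.
rewrite mulnDr; lia.
Qed.

End SosPermutation.

Section SosCycle.

Variables (k P Q : nat).
Hypotheses (Q_gt0 : 0 < Q) (Qndvd : forall l, 0 < l <= k -> ~~ (Q %| l * P)).

Let s := 2 * rot_floor_sum P Q k.+1.
Let K := rot_rank k P Q.

Lemma rot_rank_eqmodA i j : i + j = k -> eqmod k.+1 (K i + K j + 1) s.
Proof.
move=> /(rot_rankA Q_gt0 Qndvd) h; rewrite /eqmod /s.
rewrite -(modnMDl (rot_floor P Q i + rot_floor P Q j)) -[RHS](modnMDl 1).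
by congr (_ %% _); move: h; rewrite -/K mulnC; lia.
Qed.

Lemma rot_rank_eqmodB i j : 0 < i -> 0 < j -> i + j = k.+1 -> eqmod k (K i + K j) (s + 1).
Proof.
move=> i0 j0 /(rot_rankB Q_gt0 Qndvd i0 j0) h; rewrite /eqmod /s.
rewrite -(modnMDl (rot_floor P Q i + rot_floor P Q j)) -[RHS](modnMDl 1).
by congr (_ %% _); move: h; rewrite -/K mulnC; lia.
Qed.

Lemma sos_unlinkable n : eqmod k.+1 n s -> eqmod k n s -> unlinkable n k.
Proof.
by apply: (@orbit_unlinkable k s K);
  [exact: rot_rank0 | exact: rot_rank_le | exact: rot_rank_inj
  | exact: rot_rank_eqmodA | exact: rot_rank_eqmodB].
Qed.

Lemma sos_singular_lower n d e : 0 < d -> 0 < e -> e * d <= k ->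
  (forall m, m <= e -> K (m * d) = m) ->
  eqmod k.+1 (n + e) s -> eqmod k (n + e) s -> ~ unlinkable n k.
Proof.
move=> d0 e0 ed; apply: (@orbit_singular_lower k s K _ _ _ _ _ n d e) => //;
  [exact: rot_rank0 | exact: rot_rank_le | exact: rot_rank_inj
  | exact: rot_rank_eqmodA | exact: rot_rank_eqmodB].
Qed.

Lemma sos_singular_upper n d e : 0 < d -> 0 < e -> e * d <= k ->
  (forall m, 0 < m -> m <= e -> K (m * d) = k.+1 - m) ->
  eqmod k.+1 n (s + e) -> eqmod k n (s + e) -> ~ unlinkable n k.
Proof.
move=> d0 e0 ed; apply: (@orbit_singular_upper k s K _ _ _ _ _ n d e) => //;
  [exact: rot_rank0 | exact: rot_rank_le | exact: rot_rank_inj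
  | exact: rot_rank_eqmodA | exact: rot_rank_eqmodB].
Qed.

End SosCycle.

Lemma count_dvdn_iota q k : 0 < q -> count (fun i => q %| i) (iota 1 k) = k %/ q.
Proof.
move=> q0; elim: k => [|k IH]; first by rewrite div0n.
have := iotaD 1 k 1; rewrite addn1 => ->.
by rewrite count_cat IH divnS //= addn0 add1n addnC.
Qed.

(** * Perturbations of a Farey fraction *)

Section Farey.

Variables (k p q : nat).
Hypotheses (q_gt0 : 0 < q) (pq : coprime p q).

Definition floorsum := \sum_(1 <= l < k.+1) (l * p) %/ q.
(** For [l, p > 0], [(l * p - 1) %/ q] is the floor of [l * x] for [x] slightly below [p / q]. *)
Definition floorsum_left := \sum_(1 <= l < k.+1) (l * p - 1) %/ q.

Lemma dvdn_mul_coprime l : (q %| l * p) = (q %| l).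
Proof. by rewrite Gauss_dvdl // coprime_sym. Qed.

(** The floor jumps exactly at the multiples of [q] up to [k]. *)
Lemma floorsumE : 0 < p -> floorsum = floorsum_left + k %/ q.
Proof.
move=> p0; rewrite -(count_dvdn_iota k q_gt0) -sum1_count big_mkcond /=.
rewrite -[k in iota 1 k](subn1 k.+1).
rewrite -/(index_iota 1 k.+1) -big_split /=; apply: eq_big_nat => l hl.
have : 0 < l * p by nia.
case: (l * p) (dvdn_mul_coprime l) => // m <- _.
by rewrite subn1 /= divnS // addnC; case: (_ %| _).
Qed.

Let M := k.+1.

(* [P / Q] is [p / q + 1 / (q k.+1)]: close enough to [p / q] for the floors up to
   [k] to agree, and its first [k] multiples are not integers. *)
Section Right.

Let P := p * M + 1.
Let Q := q * M.

Let Q_gt0 : 0 < Q. Proof. by rewrite /Q muln_gt0 q_gt0. Qed.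

Lemma rot_res_right l : l <= k -> rot_res P Q l = (l * p) %% q * M + l.
Proof.
move=> lk; rewrite /rot_res /P /Q.
rewrite (_ : l * (p * M + 1) = l * p %/ q * (q * M) + ((l * p) %% q * M + l)).
  rewrite modnMDl modn_small //.
  have := ltn_pmod (l * p) q_gt0; move: (_ %% _) => r rq.
  by rewrite /M; nia.
by rewrite mulnDr muln1 mulnA {1}(divn_eq (l * p) q) mulnDl -mulnA addnA.
Qed.

Lemma Qndvd_right l : 0 < l <= k -> ~~ (Q %| l * P).
Proof.
move=> /andP[l0 lk]; rewrite /dvdn -/(rot_res P Q l) rot_res_right //; lia.
Qed.

Lemma rot_floor_sum_right : rot_floor_sum P Q k.+1 = floorsum.
Proof.
rewrite /rot_floor_sum big_ltn // /rot_floor mul0n div0n add0n; apply: eq_big_nat => l hl.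
rewrite /P /Q mulnC [q * M]mulnC divnMA mulnDl mul1n mulnAC divnMDl //.
by rewrite [l %/ M]divn_small ?addn0 ?[p * l]mulnC // /M; lia.
Qed.

(** A multiple [l] of [q] sits at position [l < M] and every other point at [M] or beyond, so these
    multiples open the circle in their natural order. *)
Lemma rot_rank_right m : m * q <= k -> rot_rank k P Q (m * q) = m.
Proof.
move=> mk; rewrite /rot_rank.
transitivity (count (fun i => q %| i) (iota 1 (m * q))); last first.
  by rewrite count_dvdn_iota // mulnK.
rewrite -[in LHS](subnKC mk) iotaD count_cat [X in _ + X](_ : _ = 0) ?addn0.
  apply: eq_in_count => i; rewrite mem_iota => hi.
  rewrite !rot_res_right; try lia.
  rewrite -dvdn_mul_coprime mulnAC modnMl mul0n add0n /dvdn.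
  case: eqP => [->|h]; first by lia.
  apply/negbTE; rewrite -ltnNge /M; nia.
apply/eqP; rewrite -leqn0 leqNgt -has_count; apply/hasPn => i.
rewrite mem_iota => hi; rewrite !rot_res_right; try lia.
rewrite mulnAC modnMl mul0n add0n -ltnNge; lia.
Qed.

Lemma farey_unlinkable n : eqmod k.+1 n (2 * floorsum) -> eqmod k n (2 * floorsum) ->
  unlinkable n k.
Proof.
rewrite -rot_floor_sum_right; exact: (sos_unlinkable Q_gt0 Qndvd_right).
Qed.

(** A shift by [e] relinks at [e] nonzero multiples of [q] up to [k], so this side reaches only the
    half of the jump next to [2 * floorsum]; [farey_upper] reaches the other half. *)
Lemma farey_lower n e : 0 < e <= k %/ q ->
  eqmod k.+1 (n + e) (2 * floorsum) -> eqmod k (n + e) (2 * floorsum) ->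
  ~ unlinkable n k.
Proof.
move=> /andP[e0 ek]; rewrite -rot_floor_sum_right.
apply: (sos_singular_lower Q_gt0 Qndvd_right q_gt0 e0); first by rewrite -leq_divRL.
move=> m me; apply: rot_rank_right; rewrite -leq_divRL //; exact: leq_trans ek.
Qed.

End Right.

Section Left.

Hypothesis p_gt0 : 0 < p.
(** The mirror perturbation: [P / Q] is [p / q - 1 / (q k.+1)]. *)
Let P := p * M - 1.
Let Q := q * M.

Let Q_gt0 : 0 < Q. Proof. by rewrite /Q muln_gt0 q_gt0. Qed.

Let mulP l : 0 < l <= k -> l * P = (l * p - 1) * M + (M - l).
Proof.
move=> hl; have : 0 < l * p by nia.
rewrite /P mulnBr muln1 mulnA; case: (l * p) => // c _.
by rewrite subn1 /= mulSn /M; lia.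
Qed.

Lemma rot_res_left l : 0 < l <= k -> rot_res P Q l = (l * p - 1) %% q * M + (M - l).
Proof.
move=> hl; rewrite /rot_res mulP // /Q.
rewrite {1}(divn_eq (l * p - 1) q) mulnDl -mulnA -addnA modnMDl modn_small //.
have := ltn_pmod (l * p - 1) q_gt0; move: (_ %% _) => r rq.
by rewrite /M; nia.
Qed.

Lemma Qndvd_left l : 0 < l <= k -> ~~ (Q %| l * P).
Proof.
move=> hl; rewrite /dvdn -/(rot_res P Q l) rot_res_left // /M; lia.
Qed.

Lemma rot_floor_sum_left : rot_floor_sum P Q k.+1 = floorsum_left.
Proof.
rewrite /rot_floor_sum big_ltn // /rot_floor mul0n div0n add0n; apply: eq_big_nat => l hl.
rewrite mulP // /Q [q * M]mulnC divnMA divnMDl //.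
by rewrite [(M - l) %/ M]divn_small ?addn0 // /M; lia.
Qed.

Let modp l : 0 < l -> ((l * p - 1) %% q == q.-1) = (q %| l).
Proof.
move=> l0; rewrite -dvdn_mul_coprime.
have : 0 < l * p by nia.
case: (l * p) => // c _; rewrite subn1 /= /dvdn.
rewrite -[in RHS]addn1 modnD //.
have := ltn_pmod c q_gt0; move: (c %% q) => r rq.
case: (ltnP 1 q) => q1; first by rewrite (modn_small q1); case: leqP; lia.
have r0 : r = 0 by lia.
have -> : q = 1 by lia.
by rewrite r0 modn1.
Qed.

(** The residue of [l * p - 1] is the maximal [q.-1] exactly at the multiples of [q]: they close the
    circle, reversed by the offset [M - l]. The proof counts the [m.-1] points beyond [m * q]. *)
Lemma rot_rank_left m : 0 < m -> m * q <= k -> rot_rank k P Q (m * q) = k.+1 - m.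
Proof.
move=> m0 mk; have mq0 : 0 < m * q by rewrite muln_gt0 m0.
have resm : rot_res P Q (m * q) = q.-1 * M + (M - m * q).
  rewrite rot_res_left ?mq0 //; congr (_ * _ + _).
  by apply/eqP; rewrite modp // dvdn_mull.
have : count (predC (fun i => rot_res P Q i <= rot_res P Q (m * q))) (iota 1 k) = m.-1.
  transitivity (count (fun i => q %| i) (iota 1 (m * q).-1)); last first.
    rewrite count_dvdn_iota // divn_pred mulnK // dvdn_mull //; lia.
  rewrite -[in LHS](@subnKC (m * q).-1 k) ?iotaD ?count_cat; last lia.
  rewrite [X in _ + X](_ : _ = 0) ?addn0.
    apply: eq_in_count => i; rewrite mem_iota => hi.
    rewrite /= resm rot_res_left -?ltnNge; last lia.
    rewrite -modp; last lia.
    case: eqP => [->|h]; first by rewrite /M; lia.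
    apply/negbTE; rewrite -leqNgt.
    have := ltn_pmod (i * p - 1) q_gt0.
    by move: (_ %% _) h => r h rq; rewrite /M; nia.
  apply/eqP; rewrite -leqn0 leqNgt -has_count; apply/hasPn => i.
  rewrite mem_iota => hi; rewrite /= resm rot_res_left -?ltnNge; last lia.
  rewrite ltnS leq_add // ?leq_mul2r ?leq_sub2l //; last lia.
  by rewrite -ltnS prednK ?ltn_pmod ?orbT.
have := count_predC (fun i => rot_res P Q i <= rot_res P Q (m * q)) (iota 1 k).
by rewrite size_iota -/(rot_rank k P Q (m * q)); lia.
Qed.

Lemma farey_upper n e : 0 < e <= k %/ q ->
  eqmod k.+1 n (2 * floorsum_left + e) -> eqmod k n (2 * floorsum_left + e) ->
  ~ unlinkable n k.
Proof.
move=> /andP[e0 ek]; rewrite -rot_floor_sum_left.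
apply: (sos_singular_upper Q_gt0 Qndvd_left q_gt0 e0); first by rewrite -leq_divRL.
move=> m m0 me; apply: rot_rank_left => //; rewrite -leq_divRL //; exact: leq_trans ek.
Qed.

End Left.

End Farey.

(** * Monotonicity of floor sums and the covering by Farey jumps *)

(** Floors are monotone term by term; the term [l = q'] is strict because [l * p' / q'] is an
    integer there. *)
Lemma floorsum_lt k p q p' q' : 0 < q -> 0 < q' <= k -> p * q' < p' * q ->
  floorsum k p q < floorsum k p' q'.
Proof.
move=> q0 /andP[q'0 q'k] lt_pq.
have le l : (l * p) %/ q <= (l * p') %/ q'.
  rewrite leq_divRL // -(leq_pmul2r q0) mulnAC.
  apply: (@leq_trans (l * p * q')); first by rewrite leq_mul2r leq_trunc_div orbT.
  by rewrite -!mulnA leq_mul2l (ltnW lt_pq) orbT.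
have q'in : q' \in index_iota 1 k.+1 by rewrite mem_index_iota q'0.
rewrite /floorsum (bigD1_seq q') ?iota_uniq //= [X in _ < X](bigD1_seq q') ?iota_uniq //=.
rewrite -addSn leq_add //; last by apply: leq_sum => l _.
by rewrite [q' * p']mulnC mulnK // ltn_divLR // mulnC.
Qed.

Lemma floorsum_le_cross k p q p' q' : 0 < q -> 0 < q' <= k ->
  floorsum k p' q' <= floorsum k p q -> p' * q <= p * q'.
Proof.
move=> q0 q'k; rewrite leqNgt => /negP h; rewrite leqNgt; apply/negP => h'.
exact/h/floorsum_lt.
Qed.

Lemma floorsumMl k g p q : 0 < g -> floorsum k (g * p) (g * q) = floorsum k p q.
Proof. by move=> g0; apply: eq_bigr => l _; rewrite mulnCA divnMl. Qed.

Lemma floorsum0 k q : floorsum k 0 q = 0.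
Proof. by rewrite /floorsum big1 // => l _; rewrite muln0 div0n. Qed.

Lemma floorsum11 k : 2 * floorsum k 1 1 = k * k.+1.
Proof.
rewrite /floorsum; under eq_bigr do rewrite muln1 divn1.
elim: k => [|k IH]; first by rewrite big_geq.
by rewrite big_nat_recr //= mulnDr IH; lia.
Qed.

(* Minimizing [floorsum] replaces minimizing [p / q], and the best lower approximation
   of [p / q] with denominator at most [k] is found by maximizing [floorsum]. *)
Lemma farey_cover k n : 0 < k -> 0 < n <= k * k.+1 ->
  exists p q, [/\ 0 < p <= q, q <= k, coprime p q,
    2 * floorsum_left k p q < n & n <= 2 * floorsum k p q].
Proof.
move=> k0 /andP[n0 nk].
pose T (x : 'I_k.+1 * 'I_k.+1) := [&& coprime x.1 x.2, 0 < x.1 <= x.2 &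
  n <= 2 * floorsum k x.1 x.2].
have Tx0 : T (inord 1, inord 1) by rewrite /T /= !inordK //= floorsum11.
case: (arg_minnP (fun x : 'I_k.+1 * 'I_k.+1 => floorsum k x.1 x.2) Tx0).
case=> -[p /= pk] [q /= qk] /and3P[/= pq /andP[p0 ple] npq] minpq.
exists p, q; split; rewrite ?p0 //.
rewrite ltnNge; apply/negP => nleft.
(* [m j / j.+1] is the largest fraction of denominator [j.+1] strictly below [p / q]. *)
pose m (j : 'I_k) := (j.+1 * p - 1) %/ q.
have q0 : 0 < q by apply: leq_trans ple.
case: (@arg_maxnP _ (Ordinal k0) xpredT (fun j : 'I_k => floorsum k (m j) j.+1) isT) => j _ maxj.
have mlt : m j * q < p * j.+1.
  apply: (@leq_ltn_trans (j.+1 * p - 1)); first exact: leq_trunc_div.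
  have : 0 < j.+1 * p by rewrite muln_gt0.
  by rewrite [p * _]mulnC; lia.
(* By maximality [m j / j.+1] is at least every [m l / l.+1], so its floors dominate term by
   term. *)
have le_left : floorsum_left k p q <= floorsum k (m j) j.+1.
  rewrite /floorsum_left /floorsum !big_add1 /= !big_mkord; apply: leq_sum => l _.
  rewrite leq_divRL // [l.+1 * m j]mulnC.
  by apply: floorsum_le_cross (maxj l isT) => //; rewrite ltn_ord.
have mj0 : 0 < m j.
  rewrite lt0n; apply/eqP => mj0; move: le_left; rewrite mj0 floorsum0.
  by lia.
(* The reduced form [a / b] of this fraction satisfies [T] with a smaller floor sum, against the
   minimality of [p / q]. *)
pose g := gcdn (m j) j.+1.
have g0 : 0 < g by rewrite gcdn_gt0 mj0.
have [a ea] : exists a, m j = g * a.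
  by exists (m j %/ g); rewrite mulnC divnK // dvdn_gcdl.
have [b eb] : exists b, j.+1 = g * b.
  by exists (j.+1 %/ g); rewrite mulnC divnK // dvdn_gcdr.
have ab : coprime a b.
  have : gcdn (g * a) (g * b) = g by rewrite -ea -eb.
  by move/eqP; rewrite -muln_gcdr -{2}[g]muln1 eqn_pmul2l.
have b0 : 0 < b by move: eb; case: b {ab} => //; rewrite muln0.
have a0 : 0 < a by move: ea mj0; case: a {ab} => //; rewrite muln0 => ->.
have bj : b <= j.+1 by rewrite eb leq_pmull.
have jk := ltn_ord j.
have aqpb : a * q < p * b.
  by move: mlt; rewrite eb ea -mulnA [p * _]mulnCA ltn_pmul2l.
have ale : a <= b.
  have : a * q < b * q by apply: leq_trans aqpb _; rewrite mulnC leq_mul2l ple orbT.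
  by rewrite ltn_pmul2r // => /ltnW.
have fab : floorsum k (m j) j.+1 = floorsum k a b by rewrite ea eb floorsumMl.
have bk : b < k.+1 by rewrite ltnS; apply: leq_trans bj jk.
have ak : a < k.+1 by apply: leq_ltn_trans bk.
have := minpq (Ordinal ak, Ordinal bk).
rewrite /T /= ab a0 ale /= -fab (leq_trans nleft) ?leq_mul2l ?le_left // => /(_ isT).
rewrite leqNgt => /negP; apply; rewrite fab.
by apply: floorsum_lt => //; rewrite q0.
Qed.

Local Open Scope ring_scope.

(** * The kernel of the band matrix *)

Section Symbol.

Variable R : fieldType.

Definition ones (k : nat) : {poly R} := \poly_(i < k) 1.

Lemma onesS k : ones k.+1 = 'X * ones k + 1.
Proof.
apply/polyP => i; rewrite coefD coefXM !coef_poly coef1.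
by case: i => [|i] /=; rewrite ?add0r // addr0 ltnS.
Qed.

Lemma ones_telescope k : ('X - 1) * ones k = 'X^k - 1.
Proof.
apply/polyP => i; rewrite mulrBl mul1r !coefB coefXM !coef_poly coefXn coef1.
case: i k => [|i] [|k] //=; rewrite ?ltnS ?subr0 ?sub0r ?eqSS //.
  by rewrite subrr.
by case: (ltngtP i k) => //= _; rewrite ?subrr ?subr0.
Qed.

(** The symbol of the band matrix times ['X^k]: coefficients [-1] below degree [k], [0] at [k], [1]
    from [k.+1] to [k.*2]. *)
Definition symbol k : {poly R} := ('X^k - 1) * ones k.+1.

Lemma symbolE k : symbol k = ('X^(k.+1) - 1) * ones k.
Proof. by rewrite /symbol -!ones_telescope; ring. Qed.

Lemma coef_symbol k t :
  (symbol k)`_t = (k <= t <= k.*2)%N%:R - (t <= k)%N%:R.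
Proof.
rewrite /symbol mulrBl mul1r coefB coefXnM !coef_poly ltnS.
have -> : (t - k <= k)%N = (t <= k.*2)%N by lia.
by rewrite ltnS; case: (ltnP t k) => h; case: (leqP t k); case: (leqP t k.*2) => //; lia.
Qed.

Lemma coprime_ones k : coprimep (ones k) (ones k.+1).
Proof. by rewrite onesS coprimep_addl_mul coprimep1. Qed.

(** Modulo ['X^D - 1] exponents reduce modulo [D], and the reflection [(N - i) %% D] permutes the
    residues, matching the two sums. *)
Lemma dvdp_fold D N (a b : nat -> R) : (0 < D <= N.+1)%N ->
  (forall i, (i < D)%N -> b i = a ((N - i) %% D)%N) ->
  'X^D - 1 %| \sum_(i < D) b i *: 'X^(N - i) - \sum_(i < D) a i *: 'X^i.
Proof.
move=> /andP[D0 DN] ab.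
have dvdX (c : R) t : 'X^D - 1 %| c *: 'X^t - c *: 'X^(t %% D).
  rewrite -scalerBr; case: (eqVneq c 0) => [->|c0]; first by rewrite scale0r dvdp0.
  rewrite dvdpZr // {1}(divn_eq t D) exprD -{2}['X^(t %% D)]mul1r -mulrBl.
  rewrite dvdp_mulr // mulnC exprM.
  by rewrite [X in _ %| X]subrX1 dvdp_mulr.
pose phi (i : 'I_D) : 'I_D := Ordinal (ltn_pmod (N - i) D0).
have phi_inj : injective phi.
  move=> i j /(congr1 val) /= e; apply: val_inj => /=.
  have [ilt jlt] := (ltn_ord i, ltn_ord j).
  have {}e : i = j %[mod D].
    apply/eqP; rewrite -(eqn_modDl (N - i)) subnK; last lia.
    by rewrite -modnDml e modnDml subnK //; lia.
  by move: e; rewrite !modn_small.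
rewrite [\sum_(i < D) a i *: _](reindex_inj phi_inj) -sumrB /=.
elim/big_ind: _ => [|p q|i _]; [exact: dvdp0 | exact: dvdp_add |].
by rewrite -ab.
Qed.

End Symbol.

Section Link.

Variables (n k : nat).
Hypotheses (n_gt0 : (0 < n)%N) (k_gt0 : (0 < k)%N).

Definition row_poly (v : 'rV[rat]_n) : {poly rat} := \sum_(i < n) v 0 i *: 'X^i.

(** Kernel vectors thus become polynomials whose product with [symbol] has a gap in degrees [k] to
    [n + k - 1]. *)
Lemma coef_row_polyM_symbol v (j : 'I_n) :
  (row_poly v * symbol rat k)`_(j + k) = (v *m Amat n k) 0 j.
Proof.
rewrite /row_poly mulr_suml coef_sum mxE; apply: eq_bigr => i _.
rewrite -scalerAl coefZ coefXnM mxE coef_symbol; congr (_ * _).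
have [hi hj] := (ltn_ord i, ltn_ord j).
move: (nat_of_ord i) (nat_of_ord j) hi hj => {j} i j hi hj.
case: (ltnP (j + k) i) => h.
  by rewrite !ifF //; lia.
case: (ltngtP i j) => hij /=.
- rewrite (_ : (j + k - i <= k)%N = false) ?subr0; last lia.
  rewrite (_ : (k <= j + k - i <= k.*2)%N = (j <= i + k)%N); last lia.
  by case: (j <= i + k)%N.
- rewrite (_ : (k <= j + k - i <= k.*2)%N = false); last lia.
  rewrite (_ : (j + k - i <= k)%N = true); last lia.
  by rewrite sub0r.
- rewrite hij (_ : (k <= j + k - j <= k.*2)%N = true); last lia.
  by rewrite (_ : (j + k - j <= k)%N = true) ?subrr; last lia.
Qed.

Lemma coef_row_poly v (i : 'I_n) : (row_poly v)`_i = v 0 i.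
Proof.
rewrite /row_poly coef_sum (bigD1 i) //= coefZ coefXn eqxx mulr1 big1 ?addr0 //.
by move=> j ji; rewrite coefZ coefXn val_eqE eq_sym (negbTE ji) mulr0.
Qed.

Lemma size_row_poly v : (size (row_poly v) <= n)%N.
Proof.
apply: (leq_trans (size_sum _ _ _)); apply/bigmax_leqP => i _.
by rewrite (leq_trans (size_scale_leq _ _)) // size_polyXn.
Qed.

(** The gap in [h] makes its quotients [y] and [z] by ['X^k - 1] and ['X^(k.+1) - 1] periodic below
    degree [n + k]. The ends of [z] form a linked pair, so [z] and then [V] vanish. *)
Lemma unlinkable_row_free : unlinkable n k -> row_free (Amat n k).
Proof.
move=> unl; apply: inj_row_free => v vA.
set V := row_poly v.
pose h := V * symbol rat k.
have h0 t : (k <= t < n + k)%N -> h`_t = 0.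
  move=> ht; have tn : (t - k < n)%N by lia.
  have := coef_row_polyM_symbol v (Ordinal tn); rewrite vA mxE /= subnK //; lia.
pose y := V * ones rat k.+1; pose z := V * ones rat k.
have hy : h = ('X^k - 1) * y by rewrite /h /y /symbol mulrCA.
have hz : h = ('X^(k.+1) - 1) * z by rewrite /h /z symbolE mulrCA.
have coefy t : h`_t = (if (t < k)%N then 0 else y`_(t - k)) - y`_t.
  by rewrite hy mulrBl mul1r coefB coefXnM.
have coefz t : h`_t = (if (t < k.+1)%N then 0 else z`_(t - k.+1)) - z`_t.
  by rewrite hz mulrBl mul1r coefB coefXnM.
have size_ones m : (size (ones rat m) <= m)%N by exact: size_poly.
have y0 t : (n + k <= t)%N -> y`_t = 0.
  move=> ht; apply: nth_default; apply: leq_trans (size_polyMleq _ _) _.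
  rewrite -subn1 leq_subLR.
  by apply: leq_trans (leq_add (size_row_poly v) (size_ones k.+1)) _; lia.
have z0 t : (n + k <= t.+1)%N -> z`_t = 0.
  move=> ht; apply: nth_default; apply: leq_trans (size_polyMleq _ _) _.
  rewrite -subn1 leq_subLR.
  by apply: leq_trans (leq_add (size_row_poly v) (size_ones k)) _; lia.
have yper t : (t < n + k)%N -> y`_t = y`_(t %% k).
  elim/ltn_ind: t => t IH ht; case: (ltnP t k) => tk; first by rewrite modn_small.
  have := h0 t; rewrite tk ht coefy ltnNge tk /= => /(_ isT)/subr0_eq <-.
  rewrite IH ?(leq_ltn_trans (leq_subr _ _) ht) //.
    by rewrite -[in RHS](subnK tk) modnDr.
  by rewrite ltn_subrL (leq_trans _ tk) ?k_gt0.
have zk : z`_k = 0.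
  have := h0 k; rewrite coefz ltnS leqnn sub0r => /(_ ltac:(lia))/eqP.
  by rewrite oppr_eq0 => /eqP.
have zper t : (t < n + k)%N -> z`_t = z`_(t %% k.+1).
  elim/ltn_ind: t => t IH ht; case: (ltnP t k.+1) => tk; first by rewrite modn_small.
  have := h0 t; rewrite (ltnW tk) ht coefz ltnNge tk /= => /(_ isT)/subr0_eq <-.
  rewrite IH ?(leq_ltn_trans (leq_subr _ _) ht) //.
    by rewrite -[in RHS](subnK tk) modnDr.
  by rewrite ltn_subrL (leq_trans _ tk) ?k_gt0.
(* [u 0] is the vanishing coefficient of degree [k], and [u m] for [0 < m <= k] that of degree
   [m - 1]; [w] reads [z] downwards from degree [n + k - 1]. *)
pose u m := z`_((m + k) %% k.+1); pose w m := z`_(n + k - 1 - m).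
have lnk : linked n k u w.
  split.
  - by rewrite /u add0n modn_small.
  - by rewrite /w z0 //; lia.
  - move=> m m' mk mk' hm; rewrite /u /w [RHS]zper; last lia.
    congr (z`_ _); apply/eqP; rewrite -(eqn_modDr (m' + 1)).
    rewrite (_ : m + k + (m' + 1) = m + m' + 1 + k)%N; last lia.
    by rewrite -modnDml hm modnDml; apply/eqP; congr (_ %% _)%N; lia.
  - move=> m m' mk mk' hm.
    (* In its lowest and highest degrees [h] is a single coefficient of [y] and also of [z], which
       transfers the ends of [z] to [y]. *)
    have -> : u m = y`_(m - 1).
      rewrite /u (_ : m + k = m - 1 + k.+1)%N; last lia.
      rewrite modnDr modn_small; last lia.
      have := coefy (m - 1)%N; rewrite coefz !ifT; try lia.
      by rewrite !sub0r => /oppr_inj.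
    have -> : w m' = y`_(n + k - m').
      have := coefy (n + k + k - m')%N; rewrite coefz !ifF; try lia.
      rewrite [z`_(n + k + k - m')]z0 ?[y`_(n + k + k - m')]y0; try lia.
      rewrite !subr0 /w => e; rewrite (_ : n + k - 1 - m' = n + k + k - m' - k.+1)%N; last lia.
      by rewrite e; congr (y`_ _); lia.
    rewrite [RHS]yper; last lia.
    rewrite yper; last lia.
    congr (y`_ _); apply/eqP; rewrite -(eqn_modDr (m' + 1)).
    rewrite (_ : m - 1 + (m' + 1) = m + m')%N; last lia.
    rewrite hm (_ : n + k - m' + (m' + 1) = n + 1 + k)%N; last lia.
    by rewrite modnDr.
have wz := unl _ _ lnk.
have z_0 t : z`_t = 0.
  case: (ltnP t (n + k)) => tn; last by rewrite z0 //; lia.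
  pose m' := ((n + k - 1 + k * t) %% k.+1)%N.
  have m'k : (m' <= k)%N by rewrite -ltnS ltn_pmod.
  rewrite zper // -[RHS](wz m' m'k) /w [RHS]zper; last lia.
  congr (z`_ _); apply/eqP; rewrite -(eqn_modDr m') subnK; last lia.
  rewrite /m' modnDmr (_ : t + _ = n + k - 1 + t * k.+1)%N; last nia.
  by rewrite addnC modnMDl.
have /eqP : z = 0 by apply/polyP => t; rewrite z_0 coef0.
rewrite mulf_eq0 => /orP[/eqP V0|/eqP/(congr1 (fun p : {poly rat} => p`_0))].
  by apply/rowP => i; rewrite -coef_row_poly -/V V0 coef0 mxE.
by rewrite coef_poly k_gt0 coef0 => /eqP; rewrite oner_eq0.
Qed.

(** Besides [coprime_ones], the factor ['X - 1] is harmless since [ones k.+1] takes the nonzero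
    value [k.+1] at [1]. *)
Lemma coprime_symbol : coprimep ('X^k - 1 : {poly rat}) (ones rat k.+1).
Proof.
rewrite -ones_telescope coprimepMl coprime_ones andbT coprimep_sym.
rewrite -[1]/(1%:P) coprimep_XsubC /root horner_poly.
rewrite (eq_bigr (fun=> 1)) => [|i _]; last by rewrite expr1n mulr1.
by rewrite sumr_const card_ord pnatr_eq0.
Qed.

(** A linked pair supplies the two ends of a polynomial [h] with a gap; the link conditions say that
    two coprime factors of [symbol] divide it, and the quotient would be a nonzero kernel vector. *)
Lemma row_free_unlinkable : row_free (Amat n k) -> unlinkable n k.
Proof.
move=> free u w [u0 w0 uwA uwB] m0 m0k; apply/eqP; apply/negPn/negP => wm0.
have m0_gt0 : (0 < m0)%N by case: m0 wm0 {m0k} => //; rewrite w0 eqxx.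
pose h : {poly rat} := 'X^(n + k) * \poly_(i < k) w (k - i)%N - \poly_(i < k) u i.+1.
have hcoef t : h`_t = (if (t < n + k)%N then 0 else
    if (t - (n + k) < k)%N then w (k - (t - (n + k)))%N else 0)
    - (if (t < k)%N then u t.+1 else 0).
  by rewrite coefB coefXnM !coef_poly.
have hk : h = \sum_(i < k) w i.+1 *: 'X^(n + k.*2 - 1 - i) - \sum_(i < k) u i.+1 *: 'X^i.
  rewrite /h !poly_def mulr_sumr (reindex_inj rev_ord_inj) /=; congr (_ - _).
  apply: eq_bigr => i _; rewrite -scalerAr -exprD; have := ltn_ord i => hi.
  by congr (w _ *: 'X^ _); lia.
have dvd1 : 'X^k - 1 %| h.
  rewrite hk (dvdp_fold (b := fun i => w i.+1) (a := fun i => u i.+1)) //; first lia.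
  move=> i ik; apply/esym/uwB; [|lia|].
    by rewrite /= ltn_pmod.
  rewrite /eqmod (_ : (_ %% k).+1 + i.+1 = (n + k.*2 - 1 - i) %% k + i.+2)%N; last lia.
  rewrite modnDml (_ : n + k.*2 - 1 - i + i.+2 = n + 1 + 2 * k)%N; last lia.
  by rewrite addnC modnMDl.
have dvd2 : 'X^(k.+1) - 1 %| h.
  (* The vanishing [w 0] and [u 0] pad both sums to [k.+1] terms. *)
  have -> : h = \sum_(i < k.+1) w i *: 'X^(n + k.*2 - i)
     - \sum_(i < k.+1) u (i.+1 %% k.+1)%N *: 'X^i.
    rewrite hk big_ord_recl [w _]w0 scale0r add0r; congr (_ - _).
      by apply: eq_bigr => i _; congr (_ *: 'X^ _); rewrite lift0; lia.
    rewrite big_ord_recr /= modnn u0 scale0r addr0; apply: eq_bigr => i _.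
    by rewrite modn_small // ltnS.
  apply: (dvdp_fold (b := w) (a := fun i => u (i.+1 %% k.+1)%N)); first lia.
  move=> i ik; apply/esym/uwA => //; first by rewrite -ltnS ltn_pmod.
  rewrite /eqmod -addnA modnDml -addn1 -addnA modnDml.
  rewrite (_ : n + k.*2 - i + _ = n + 2 * k.+1)%N; last lia.
  by rewrite addnC modnMDl.
have dvdf : symbol rat k %| h.
  rewrite Gauss_dvdp ?coprime_symbol // dvd1 /=.
  apply: dvdp_trans dvd2; rewrite -ones_telescope dvdp_mull //.
have [V hV] : exists V, h = V * symbol rat k.
  by exists (h %/ symbol rat k); rewrite divpK.
have h_neq0 : h`_(n + k + (k - m0)) != 0.
  have [h1 h2] : (n + k + (k - m0) < n + k)%N = false /\ (n + k + (k - m0) < k)%N = false by lia.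
  rewrite hcoef h1 h2 subr0 addKn ifT; last lia.
  by rewrite (_ : k - _ = m0)%N //; lia.
have sf : size (symbol rat k) = k.*2.+1.
  have s1 : size ('X^k - 1 : {poly rat}) = k.+1 by rewrite -[1]/(1%:P) size_XnsubC.
  have s2 : size (ones rat k.+1) = k.+1 by rewrite size_poly_eq ?oner_eq0.
  rewrite /symbol size_mul -?size_poly_eq0 ?s1 ?s2 //; lia.
have szh : (size h <= n + k.*2)%N.
  apply/leq_sizeP => t ht; rewrite hcoef !ifF ?subr0 //; lia.
have V0 : V != 0.
  by apply/eqP => V0; move: h_neq0; rewrite hV V0 mul0r coef0 eqxx.
have szV : (size V <= n)%N.
  by move: szh; rewrite hV size_mul -?size_poly_eq0 ?sf // ?size_poly_eq0 // addnS /= leq_add2r.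
pose v : 'rV[rat]_n := \row_i V`_i.
have Vv : row_poly v = V.
  apply/polyP => t; case: (ltnP t n) => tn.
    by rewrite -[t]/(nat_of_ord (Ordinal tn)) coef_row_poly mxE.
  by rewrite !nth_default // (leq_trans _ tn) // size_row_poly.
have vA : v *m Amat n k = 0.
  apply/rowP => j; rewrite -coef_row_polyM_symbol Vv -hV hcoef mxE.
  by rewrite ifT ?ifF ?subr0 //; have := ltn_ord j; lia.
move/eqP: vA; rewrite mulmx_free_eq0 // => /eqP v0.
by move: V0; rewrite -Vv v0 /row_poly big1 ?eqxx // => i _; rewrite mxE scale0r.
Qed.

Lemma nullity_eq0P : reflect (unlinkable n k) (nullity n k == 0)%N.
Proof.
apply: (iffP eqP) => [nul|unl].
  apply: row_free_unlinkable; rewrite /row_free eqn_leq rank_leq_row.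
  by move/eqP: nul; rewrite subn_eq0.
by rewrite /nullity (eqP (unlinkable_row_free unl)) subnn.
Qed.

End Link.

(** * Regular residues and their number *)

Section Zeros.

Local Open Scope nat_scope.

(** A positive [n] lies in some Farey jump, and the values strictly inside are singular, so only the
    upper end is left. The fraction [1] is excluded because its end is [k ^ 2 + k]. *)
Lemma Nres_eq0P k n : 0 < k -> n < k ^ 2 + k ->
  reflect (exists p q, [/\ p < q, q <= k, coprime q p & n = 2 * floorsum k p q])
    (Nres n k == 0).
Proof.
have kE : k ^ 2 + k = k * k.+1 by lia.
move=> k0; rewrite kE => nk.
have n'0 : 0 < n + (k ^ 2 + k) by lia.
have modA a b : eqmod k.+1 a b -> eqmod k.+1 (a + (k ^ 2 + k)) b.
  by rewrite kE /eqmod addnC modnMDl.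
have modB a b : eqmod k a b -> eqmod k (a + (k ^ 2 + k)) b.
  by rewrite kE mulnC /eqmod addnC modnMDl.
apply: (iffP (nullity_eq0P n'0 k0)) => [unl|[p [q [pq qk cpq en]]]]; last first.
  have q0 : 0 < q by apply: leq_ltn_trans pq.
  by apply: (@farey_unlinkable k p q q0); rewrite 1?coprime_sym //;
    [apply: modA | apply: modB]; rewrite en.
case: (posnP n) => [->|n0].
  by exists 0, 1; rewrite floorsum0.
have [|p [q [/andP[p0 pq] qk cpq lo hi]]] := @farey_cover k n k0; first by lia.
have q0 : 0 < q by apply: leq_trans pq.
have eS := floorsumE k q0 cpq p0.
case: (ltnP n (2 * floorsum k p q)) => [lt_n|ge_n].
  (* The jump has length [2 * (k %/ q)]; the case split is at its midpoint. *)
  case: (leqP (n + k %/ q) (2 * floorsum k p q)) => h.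
    exfalso; move: unl.
    apply: (@farey_upper k p q q0 cpq p0 _ (n - 2 * floorsum_left k p q)).
    - by lia.
    - by apply: modA; rewrite subnKC //; lia.
    - by apply: modB; rewrite subnKC //; lia.
  exfalso; move: unl.
  apply: (@farey_lower k p q q0 cpq _ (2 * floorsum k p q - n)).
  - by lia.
  - by rewrite addnAC; apply: modA; rewrite subnKC //; lia.
  - by rewrite addnAC; apply: modB; rewrite subnKC //; lia.
have en : n = 2 * floorsum k p q by lia.
exists p, q; split; rewrite // 1?coprime_sym //.
rewrite ltn_neqAle pq andbT; apply/eqP => epq.
move: cpq; rewrite epq /coprime gcdnn => /eqP q1.
by move: nk; rewrite en epq q1 floorsum11 ltnn.
Qed.

Lemma floorsum_inj k p q p' q' : p < q -> q <= k -> coprime q p ->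
  p' < q' -> q' <= k -> coprime q' p' -> floorsum k p q = floorsum k p' q' ->
  (q, p) = (q', p').
Proof.
move=> pq qk cpq pq' qk' cpq' e.
have q0 : 0 < q by apply: leq_ltn_trans pq.
have q0' : 0 < q' by apply: leq_ltn_trans pq'.
have cross : p * q' = p' * q.
  apply/eqP; rewrite eqn_leq; apply/andP; split; apply: (@floorsum_le_cross k);
    by rewrite ?q0 ?q0' ?e.
have eq_q : q = q'.
  apply/eqP; rewrite eqn_dvd; apply/andP; split.
    by rewrite -(@Gauss_dvdr q p q') // cross dvdn_mull.
  by rewrite -(@Gauss_dvdr q' p' q) // -cross dvdn_mull.
by move: cross => /eqP; rewrite eq_q eqn_pmul2r // => /eqP ->.
Qed.

(** By strict monotonicity [2 * floorsum] is a bijection from the Farey fractions in [[0, 1)] to the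
    regular residues. *)
Lemma count_Nres_eq0 k : 0 < k ->
  count (fun n => Nres n k == 0) (iota 0 (k ^ 2 + k)) =
  \sum_(1 <= q < k.+1) totient q.
Proof.
move=> k0.
pose pairs := [seq (q, p) | q <- iota 1 k, p <- [seq p <- iota 0 q | coprime q p]].
pose f (x : nat * nat) := 2 * floorsum k x.2 x.1.
have pairsP x : x \in pairs -> [/\ x.2 < x.1, x.1 <= k & coprime x.1 x.2].
  case/allpairsPdep => q [p [qk pq ->]] /=; move: qk pq.
  by rewrite mem_filter !mem_iota /= add0n add1n ltnS => /andP[_ ->] /andP[-> ->].
have upairs : uniq pairs.
  apply: allpairs_uniq_dep => [|q _|]; rewrite ?iota_uniq ?filter_uniq ?iota_uniq //.
  by move=> [q p] [q' p'] _ _ /= [-> ->].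
transitivity (size (map f pairs)).
  rewrite -size_filter; apply/perm_size/uniq_perm.
  - by rewrite filter_uniq ?iota_uniq.
  - rewrite map_inj_in_uniq // => -[q p] [q' p'] /pairsP[/= h1 h2 h3] /pairsP[/= h1' h2' h3'].
    by move=> /eqP; rewrite /f eqn_pmul2l // => /eqP; apply: floorsum_inj.
  move=> n; rewrite mem_filter mem_iota add0n /=.
  apply/andP/mapP => [[z nk]|[[q p] hx ->]].
    have [p [q [pq qk cpq en]]] := Nres_eq0P k0 nk z.
    exists (q, p) => //; apply/allpairsPdep; exists q, p; split=> //.
      by rewrite mem_iota add1n ltnS qk (leq_ltn_trans _ pq).
    by rewrite mem_filter cpq mem_iota.
  have [/= pq qk cpq] := pairsP _ hx.
  have lt : f (q, p) < k ^ 2 + k.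
    rewrite (_ : k ^ 2 + k = k * k.+1); last lia.
    rewrite -floorsum11 /f ltn_pmul2l // floorsum_lt ?(leq_ltn_trans _ pq) //.
    by rewrite muln1 mul1n.
  by split=> //; apply/Nres_eq0P => //; exists p, q.
rewrite size_map size_allpairs_dep sumnE big_map /index_iota subn1.
apply: eq_bigr => q _; rewrite size_filter totient_count_coprime -sum1_count.
by rewrite big_mkcond /index_iota subn0.
Qed.

End Zeros.

Local Open Scope classical_set_scope.
Local Open Scope ring_scope.

(** * The Basel problem *)

Section Basel.

Variable R : realType.

Lemma sin_le_id (x : R) : 0 <= x -> sin x <= x.
Proof.
move=> x0; have [|c _] := @MVT_segment R sin cos 0 x x0 _.
  by apply: continuous_subspaceT; exact: continuous_sin.
rewrite sin0 !subr0 => ->; rewrite ler_piMl //; exact: cos_le1.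
Qed.

Lemma tan_ge_id (x : R) : 0 <= x < pi / 2 -> x <= tan x.
Proof.
move=> /andP[x0 xpi].
have cos_gt0 c : 0 <= c <= x -> 0 < cos c :> R.
  by move=> hc; apply: cos_gt0_pihalf; have := @pi_gt0 R; lra.
have [c hc||c hc] := @MVT_segment R tan (fun t => (cos t) ^- 2) 0 x x0.
- apply: is_derive_tan; rewrite gt_eqF // cos_gt0 //.
  by move: hc; rewrite in_itv /= => /andP[/ltW -> /ltW ->].
- apply/continuous_in_subspaceT => c; rewrite inE /= in_itv /= => hc.
  by apply: continuous_tan; rewrite gt_eqF // cos_gt0.
rewrite tan0 !subr0 => ->; rewrite ler_peMl // invf_ge1 ?exprn_gt0 ?cos_gt0 //.
Qed.

Definition csc2 (x : R) := (sin x ^+ 2)^-1.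

Lemma csc2_ge (x : R) : 0 < x < pi / 2 -> x ^- 2 <= csc2 x.
Proof.
move=> hx; have s0 : 0 < sin x by apply: sin_gt0_pihalf.
case/andP: hx => x0 xp.
rewrite /csc2 lef_pV2 ?posrE ?exprn_gt0 //.
by rewrite ler_pXn2r ?nnegrE ?(ltW x0) ?(ltW s0) // sin_le_id // ltW.
Qed.

(** [csc2] is the squared cotangent plus [1], and the cotangent is at most [1 / x]. *)
Lemma csc2_le (x : R) : 0 < x < pi / 2 -> csc2 x <= x ^- 2 + 1.
Proof.
move=> hx; have s0 : 0 < sin x by apply: sin_gt0_pihalf.
case/andP: (hx) => x0 xp.
have c0 : 0 < cos x by apply: cos_gt0_pihalf; have := @pi_gt0 R; lra.
have -> : csc2 x = (cos x / sin x) ^+ 2 + 1.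
  rewrite /csc2 expr_div_n cos2sin2 mulrBl mul1r divff ?subrK //.
  by rewrite expf_neq0 // gt_eqF.
rewrite lerD2r -exprVn ler_pXn2r ?nnegrE ?divr_ge0 ?invr_ge0 ?(ltW x0) ?(ltW s0) ?(ltW c0) //.
have : x <= tan x by apply: tan_ge_id; rewrite (ltW x0).
by rewrite /tan -[cos x / sin x]invf_div lef_pV2 ?posrE ?divr_gt0.
Qed.

Lemma csc2_double (x : R) : 0 < x < pi / 2 ->
  4 * csc2 x = csc2 (x / 2) + csc2 (pi / 2 - x / 2).
Proof.
move=> /andP[x0 xp].
have s0 : 0 < sin (x / 2) by apply: sin_gt0_pihalf; have := @pi_gt0 R; lra.
have c0 : 0 < cos (x / 2) by apply: cos_gt0_pihalf; have := @pi_gt0 R; lra.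
have -> : csc2 (pi / 2 - x / 2) = (cos (x / 2) ^+ 2)^-1.
  by rewrite /csc2 addrC sinDpihalf cosN.
have -> : csc2 x = ((cos (x / 2) * sin (x / 2)) *+ 2) ^- 2.
  by rewrite -sin_mulr2n -[(x / 2) *+ 2]mulr_natr divfK.
have := cos2Dsin2 (x / 2); rewrite /csc2.
move: (sin _) (cos _) s0 c0 => s c s0 c0 e.
have sn : s != 0 by rewrite gt_eqF.
have cn : c != 0 by rewrite gt_eqF.
have -> : 4 / (c * s *+ 2) ^+ 2 = (c ^+ 2 + s ^+ 2) / (c * s) ^+ 2.
  by rewrite e; field; rewrite sn cn.
by field; rewrite sn cn.
Qed.

Definition dyadic_angle n j : R := (2 * j + 1)%N%:R * pi / (2 ^ n.+2)%N%:R.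

Lemma dyadic_angle_itv n j : (j < 2 ^ n)%N -> 0 < dyadic_angle n j < pi / 2.
Proof.
move=> jn; rewrite /dyadic_angle; have p0 := @pi_gt0 R.
have e : (2 ^ n.+2 = 2 * (2 ^ n.+1))%N by rewrite expnS.
have h1 : (2 * j + 1 < 2 ^ n.+1)%N by rewrite expnS; lia.
have d0 : 0 < (2 ^ n.+1)%N%:R :> R by rewrite ltr0n expn_gt0.
rewrite divr_gt0 ?mulr_gt0 ?ltr0n ?expn_gt0 ?addn1 //=.
rewrite e natrM ltr_pdivrMr ?mulr_gt0 //.
have : (2 * j).+1%:R < (2 ^ n.+1)%N%:R :> R by rewrite ltr_nat -addn1.
by nra.
Qed.

(* Induction on [n] with [csc2_double]: halving an angle of level [n] and taking the
   complement gives two angles of level [n.+1]. *)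
Lemma sum_csc2 n : \sum_(0 <= j < 2 ^ n) csc2 (dyadic_angle n j) = 2 * 4 ^+ n.
Proof.
elim: n => [|n IH].
  rewrite big_nat1 /dyadic_angle muln0 add0n mul1r expr0 mulr1.
  have := @sin_mulr2n R (pi / 4); have := cos2Dsin2 (pi / 4 : R).
  have := @cos_mulr2n R (pi / 4).
  rewrite (_ : (pi / 4) *+ 2 = pi / 2 :> R); last by rewrite -mulr_natr; field.
  rewrite cos_pihalf /csc2 => h1 h2 _.
  rewrite (_ : sin (pi / 4 : R) ^+ 2 = 2^-1) ?invrK //.
  by move: h1; rewrite -mulr_natr; lra.
have two : (2 ^ n.+1 = 2 ^ n + 2 ^ n)%N by rewrite expnS; lia.
rewrite (@big_cat_nat _ _ _ (2 ^ n)) //=; last by rewrite two leq_addr.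
(* The upper half of the angles, reversed, consists of the complements of the lower half. *)
have -> : \sum_(2 ^ n <= j < 2 ^ n.+1) csc2 (dyadic_angle n.+1 j) =
   \sum_(0 <= j < 2 ^ n) csc2 (dyadic_angle n.+1 (2 ^ n.+1 - 1 - j)%N).
  rewrite -{1}[(2 ^ n)%N]add0n big_addn {1}two addnK big_nat_rev /= add0n.
  by apply: eq_big_nat => j hj; congr (csc2 (dyadic_angle _ _)); lia.
rewrite -big_split /= exprS mulrCA -IH mulr_sumr; apply: eq_big_nat => j /andP[_ hj].
rewrite csc2_double ?dyadic_angle_itv //; congr (csc2 _ + csc2 _).
  by rewrite /dyadic_angle [in LHS](expnS 2 n.+2) natrM; field; rewrite pnatr_eq0 expn_eq0.
rewrite /dyadic_angle.
have e1 : (2 * (2 ^ n.+1 - 1 - j) + 1)%N%:R = (2 ^ n.+2)%N%:R - (2 * j + 1)%N%:R :> R.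
  by rewrite -natrB; [congr (_%:R)|]; rewrite ?expnS; lia.
rewrite e1 (expnS 2 n.+2) natrM; field; rewrite pnatr_eq0 expn_eq0 //.
Qed.

Definition odd_zeta2 m : R := \sum_(0 <= j < m) (2 * j + 1)%N%:R ^- 2.
Definition zeta2 m : R := \sum_(1 <= d < m.+1) d%:R ^- 2.

(** Sum [x^-2 <= csc2 x <= x^-2 + 1] over the [2 ^ n] angles: the slack [2 ^+ n] is divided by the
    scale [16 * 4 ^+ n / pi ^+ 2]. *)
Lemma odd_zeta2_bounds n :
  pi ^+ 2 / 8 - pi ^+ 2 / 16 * 2 ^- n <= odd_zeta2 (2 ^ n) <= pi ^+ 2 / 8.
Proof.
have p0 := @pi_gt0 R.
have e4 : 4 ^+ n = (2 ^+ n) ^+ 2 :> R by rewrite -exprM mulnC exprM; congr (_ ^+ _); rewrite -natrX.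
have d0 : 0 < 2 ^+ n :> R by rewrite exprn_gt0.
have eS : \sum_(0 <= j < 2 ^ n) (dyadic_angle n j) ^- 2 =
    16 * 4 ^+ n / pi ^+ 2 * odd_zeta2 (2 ^ n).
  rewrite /odd_zeta2 mulr_sumr; apply: eq_bigr => j _.
  have j0 : 0 < (2 * j + 1)%N%:R :> R by rewrite ltr0n addn1.
  rewrite /dyadic_angle natrX !exprS e4.
  move: (@pi R) (_%:R) p0 j0 => p x p0 j0; field.
  by rewrite !gt_eqF.
have lo : \sum_(0 <= j < 2 ^ n) (dyadic_angle n j) ^- 2 <= 2 * 4 ^+ n.
  rewrite -sum_csc2; apply: ler_sum_nat => j /andP[_ hj].
  by apply: csc2_ge; apply: dyadic_angle_itv.
have hi : 2 * 4 ^+ n <= \sum_(0 <= j < 2 ^ n) (dyadic_angle n j) ^- 2 + 2 ^+ n.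
  have -> : 2 ^+ n = \sum_(0 <= j < 2 ^ n) 1 :> R.
    by rewrite big_mkord sumr_const card_ord natrX.
  rewrite -sum_csc2 -big_split /=; apply: ler_sum_nat => j /andP[_ hj].
  by apply: csc2_le; apply: dyadic_angle_itv.
move: lo hi; rewrite eS e4.
move: (odd_zeta2 _) (2 ^+ n) d0 {eS} => S d d0.
move: (@pi R) p0 => p p0 lo hi.
have pn : p != 0 by rewrite gt_eqF.
have dn : d != 0 by rewrite gt_eqF.
have q0 : 0 < 16 * d ^+ 2 / p ^+ 2 by rewrite divr_gt0 ?mulr_gt0 ?exprn_gt0.
apply/andP; split; rewrite -(ler_pM2l q0).
  rewrite (_ : _ * (_ - _) = 2 * d ^+ 2 - d); first by rewrite lerBlDr.
  by field; rewrite pn dn.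
rewrite (_ : _ * (p ^+ 2 / 8) = 2 * d ^+ 2) //.
by field; rewrite pn.
Qed.

Lemma zeta2_double m : zeta2 (2 * m) = odd_zeta2 m + zeta2 m / 4.
Proof.
rewrite /zeta2 /odd_zeta2; elim: m => [|m IH].
  by rewrite muln0 !big_geq // mul0r addr0.
rewrite (_ : (2 * m.+1 = (2 * m).+2)%N); last lia.
rewrite big_nat_recr // big_nat_recr //= IH.
rewrite [\sum_(0 <= j < m.+1) _]big_nat_recr //= [\sum_(1 <= d < m.+2) _]big_nat_recr //= mulrDl.
have -> : (2 * m).+2%:R = 2 * m.+1%:R :> R by rewrite -natrM; congr (_%:R); lia.
rewrite addn1.
have x0 : m.+1%:R != 0 :> R by rewrite pnatr_eq0.
have y0 : (2 * m).+1%:R != 0 :> R by rewrite pnatr_eq0.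
move: (\sum_(0 <= j < m) _) (\sum_(1 <= d < m.+1) _) (m.+1%:R) ((2 * m).+1%:R) x0 y0.
by move=> A B x y x0 y0; field; rewrite x0 y0.
Qed.

(** As [pi^2 / 6 = pi^2 / 8 + (pi^2 / 6) / 4], the error obeys the recursion of [zeta2_double]; both
    contributions are at most [pi^2 / 16 * 2 ^- n]. *)
Lemma zeta2_pow2 n : `|pi ^+ 2 / 6 - zeta2 (2 ^ n)| <= pi ^+ 2 / 4 * 2 ^- n.
Proof.
have p2 := @pi_ge2 R.
have p4 : 4 <= pi ^+ 2 :> R by rewrite (_ : 4 = 2 ^+ 2) ?ler_pXn2r ?nnegrE -?natrX //; lra.
elim: n => [|n IH].
  rewrite /zeta2 expn0 big_nat1 expr1n !expr0 !invr1 mulr1.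
  rewrite ler_norml; apply/andP; split; lra.
rewrite expnS zeta2_double.
have /andP[h1 h2] := odd_zeta2_bounds n.
move: IH; rewrite !ler_norml => /andP[h3 h4].
rewrite [2 ^+ n.+1]exprS invfM.
move: (odd_zeta2 _) (zeta2 _) (2 ^- n) h1 h2 h3 h4 => S Z d h1 h2 h3 h4.
apply/andP; split; nra.
Qed.

Lemma zeta2_mono m m' : (m <= m')%N -> zeta2 m <= zeta2 m'.
Proof.
move=> mm; rewrite /zeta2 [leRHS](@big_cat_nat _ _ _ m.+1) //= lerDl.
by apply: sumr_ge0 => i _; rewrite invr_ge0 exprn_ge0.
Qed.

Lemma zeta2_cvg (eps : R) : 0 < eps ->
  exists N, forall m, (N <= m)%N -> `|pi ^+ 2 / 6 - zeta2 m| <= eps.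
Proof.
move=> e0; pose C : R := pi ^+ 2 / 4.
have C0 : 0 < C by rewrite divr_gt0 // exprn_gt0 // pi_gt0.
have [N0 hN0] : exists N, forall m, (N <= m)%N -> C * 2 ^- m <= eps.
  exists (Num.bound (C / eps)) => m hm.
  rewrite ler_pdivrMr ?exprn_gt0 // mulrC -ler_pdivrMr //.
  have := archi_boundP (ltW (divr_gt0 C0 e0)) => /ltW h; apply: le_trans h _.
  by rewrite -natrX ler_nat (leq_trans hm) // ltnW // ltn_expl.
(* Since [2 ^ N0 <= m <= 2 ^ m], monotonicity confines [zeta2 m] between two controlled values. *)
exists (2 ^ N0)%N => m hm.
have := zeta2_pow2 N0; have := zeta2_pow2 m; rewrite -/C.
have := hN0 N0 (leqnn _); have := hN0 m.
have := zeta2_mono hm; have := @zeta2_mono m (2 ^ m)%N (ltnW (ltn_expl m (isT : (1 < 2)%N))).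
rewrite !ler_norml => h1 h2 /(_ ltac:(by apply: leq_trans hm; rewrite ltnW // ltn_expl)).
move=> h3 h4 /andP[h5 h6] /andP[h7 h8].
apply/andP; split; lra.
Qed.

(** Keep [1 / 4] and telescope [d^-2 <= 1 / (d - 1) - 1 / d] from [d = 3] on. A constant below [1]
    is what the contraction needs. *)
Lemma zeta2_tail_le m : \sum_(2 <= d < m.+1) d%:R ^- 2 <= 3 / 4 :> R.
Proof.
case: m => [|m]; first by rewrite big_geq //; lra.
case: m => [|m]; first by rewrite big_geq //; lra.
suff : \sum_(2 <= d < m.+3) d%:R ^- 2 <= 3 / 4 - m.+2%:R^-1 :> R.
  by move=> h; apply: le_trans h _; rewrite gerBl.
elim: m => [|m IH]; first by rewrite big_nat1; lra.
rewrite big_nat_recr //=; move: IH; set S := \sum_(_ <= _ < _) _ => IH.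
have e : m.+3%:R = m.+2%:R + 1 :> R by rewrite -natr1.
have x0 : 0 < m.+2%:R :> R by [].
rewrite e; move: (m.+2%:R) x0 IH => x x0 IH.
have : (x + 1) ^- 2 <= x^-1 - (x + 1)^-1.
  rewrite -subr_ge0 (_ : _ - _ = (x * (x + 1) ^+ 2)^-1); last first.
    by field; rewrite !gt_eqF //; lra.
  by rewrite invr_ge0 mulr_ge0 ?exprn_ge0 //; lra.
lra.
Qed.

End Basel.

(** * The summatory function of the totient *)

Definition totient_sum k := (\sum_(1 <= q < k.+1) totient q)%N.

Lemma sum_totient_divn n : (0 < n)%N ->
  (\sum_(1 <= d < n.+1 | d %| n) totient (n %/ d) = n)%N.
Proof.
move=> n0; rewrite -[RHS](sum_totient_dvd n).
pose h (d : 'I_n.+1) : 'I_n.+1 := inord (n %/ d).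
have hE d : h d = (n %/ d)%N :> nat by rewrite inordK // ltnS leq_div.
have hK (d : 'I_n.+1) : (d %| n)%N -> h (h d) = d.
  by move=> dn; apply: val_inj; rewrite /= hE hE divnA // mulKn.
rewrite [RHS](reindex_onto h h) => [|d dn]; last exact: hK.
rewrite [RHS](eq_bigl (fun d : 'I_n.+1 => d %| n)%N).
  under [RHS]eq_bigr do rewrite hE.
  rewrite -(big_mkord (fun d => d %| n)%N (fun d => totient (n %/ d))).
  rewrite [RHS]big_mkcond [RHS]big_ltn //= dvd0n (gtn_eqF n0) add0n.
  by rewrite -big_mkcond.
move=> d; apply/andP/idP => [[hd /eqP <-]|dn].
  by rewrite hE dvdn_div.
by rewrite hK // hE dvdn_div.
Qed.

(** From [k] to [k.+1] the quotient by [d] grows only if [d] divides [k.+1], and the increments sum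
    to [k.+1]. *)
Lemma totient_sum_divn k :
  (\sum_(1 <= d < k.+1) totient_sum (k %/ d) = \sum_(1 <= m < k.+1) m)%N.
Proof.
elim: k => [|k IH]; first by rewrite !big_geq.
rewrite [RHS]big_nat_recr //= -IH.
have -> : (\sum_(1 <= d < k.+1) totient_sum (k %/ d) =
           \sum_(1 <= d < k.+2) totient_sum (k %/ d))%N.
  by rewrite [RHS]big_nat_recr //= divn_small // /totient_sum [X in (_ + X)%N]big_geq ?addn0.
transitivity (\sum_(1 <= d < k.+2) totient_sum (k %/ d) +
  \sum_(1 <= d < k.+2 | d %| k.+1) totient (k.+1 %/ d))%N; last by rewrite sum_totient_divn.
rewrite [X in (_ + X)%N]big_mkcond -big_split /=; apply: eq_big_nat => d /andP[d0 dk].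
rewrite divnS //; case: (boolP (d %| k.+1)%N) => hd; last by rewrite add0n addn0.
by rewrite add1n /totient_sum [LHS]big_nat_recr.
Qed.

Lemma totient_le q : (totient q <= q)%N.
Proof.
rewrite totient_count_coprime -[leqRHS]subn0 -[leqRHS]muln1 -sum_nat_const_nat.
by apply: leq_sum => d _; case: coprime.
Qed.

Lemma totient_sum_le k : (totient_sum k <= k * k)%N.
Proof.
apply: (@leq_trans (\sum_(1 <= q < k.+1) k)%N).
  rewrite /totient_sum !big_nat; apply: leq_sum => q hq.
  by apply: leq_trans (totient_le q) _; lia.
by rewrite sum_nat_const_nat subn1.
Qed.

Definition farey_density (R : realType) : R := 3 / pi ^+ 2.

Section TotientSum.

Variable R : realType.

Local Notation c := (farey_density R).

Lemma farey_density_gt0 : 0 < c.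
Proof. by rewrite divr_gt0 // exprn_gt0 // pi_gt0. Qed.

Let c_gt0 := farey_density_gt0.

Definition totient_err k : R := (totient_sum k)%:R - c * k%:R ^+ 2.

Lemma totient_err_bound k : `|totient_err k| <= (1 + c) * k%:R ^+ 2.
Proof.
rewrite /totient_err; have := totient_sum_le k.
rewrite -(ler_nat R) natrM -expr2 => h.
have h0 : 0 <= (totient_sum k)%:R :> R by [].
have h1 : 0 <= c * k%:R ^+ 2 by rewrite mulr_ge0 ?exprn_ge0 // ltW.
by rewrite ler_norml mulrDl mul1r; apply/andP; split; lra.
Qed.

Lemma nat_ge_ex (x : R) : exists N, forall k, (N <= k)%N -> x <= k%:R.
Proof.
exists (Num.bound `|x|) => k hk; apply: le_trans (ler_norm x) _.
by apply: le_trans (ltW (archi_boundP (normr_ge0 x))) _; rewrite ler_nat.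
Qed.

Lemma divn_le_real k d : (0 < d)%N -> (k %/ d)%:R <= k%:R / d%:R :> R.
Proof.
by move=> d0; rewrite ler_pdivlMr ?ltr0n // -natrM ler_nat leq_trunc_div.
Qed.

Lemma divn_ge_real k d : (0 < d)%N -> k%:R / d%:R - 1 <= (k %/ d)%:R :> R.
Proof.
move=> d0; rewrite lerBlDr ler_pdivrMr ?ltr0n // natr1 -natrM ler_nat.
by rewrite ltnW // ltn_ceil.
Qed.

(** An arbitrarily small slope replaces the logarithm: completing the square gives
    [1 / d <= eta + 1 / (4 * eta * d^2)]. *)
Lemma harmonic_le k (eta : R) : 0 < eta ->
  \sum_(1 <= d < k.+1) d%:R^-1 <= eta * k%:R + eta^-1 :> R.
Proof.
move=> e0.
apply: (@le_trans _ _ (\sum_(1 <= d < k.+1) (eta + (4 * eta)^-1 * d%:R ^- 2))).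
  apply: ler_sum_nat => d /andP[d0 _].
  have x0 : 0 < d%:R :> R by rewrite ltr0n.
  move: (d%:R) x0 => x x0; rewrite -subr_ge0.
  rewrite (_ : _ - _ = (2 * eta * x - 1) ^+ 2 / (4 * eta * x ^+ 2)).
    by rewrite divr_ge0 ?sqr_ge0 // !mulr_ge0 ?exprn_ge0 // ltW.
  by field; rewrite !gt_eqF.
rewrite big_split /= sumr_const_nat subn1 /= -[eta *+ _]mulr_natr lerD2l -mulr_sumr.
case: k => [|k]; first by rewrite big_geq // mulr0 invr_ge0 ltW.
rewrite big_ltn // expr1n invr1 invfM.
have := zeta2_tail_le R k.+1.
have : 0 < eta^-1 by rewrite invr_gt0.
move: (\sum_(_ <= _ < _) _) (eta^-1) => S y y0 hS; nra.
Qed.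

Definition err_sum k := \sum_(1 <= d < k.+1) totient_err (k %/ d).

Lemma err_sumE k : err_sum k =
  (k * k.+1)%N%:R / 2 - c * \sum_(1 <= d < k.+1) (k %/ d)%:R ^+ 2.
Proof.
rewrite /err_sum big_split /= sumrN -mulr_sumr; congr (_ - _).
rewrite -natr_sum totient_sum_divn.
have -> : (k * k.+1 = 2 * \sum_(1 <= m < k.+1) m)%N.
  elim: k => [|k IH]; first by rewrite big_geq.
  by rewrite big_nat_recr //= mulnDr -IH; lia.
by rewrite natrM [2%:R * _]mulrC mulfK // pnatr_eq0.
Qed.

(** Replacing [x = k / d] by its floor costs at most [2 * x] in the square, which leaves a harmonic
    sum. *)
Lemma sum_divn_sqr_bounds k (eta : R) : 0 < eta ->
  let S := \sum_(1 <= d < k.+1) (k %/ d)%:R ^+ 2 in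
  k%:R ^+ 2 * zeta2 R k - 2 * k%:R * (eta * k%:R + eta^-1) <= S
  <= k%:R ^+ 2 * zeta2 R k.
Proof.
move=> e0 /=; apply/andP; split; last first.
  rewrite /zeta2 mulr_sumr; apply: ler_sum_nat => d /andP[d0 _].
  by rewrite -expr_div_n ler_pXn2r ?nnegrE ?divr_ge0 // divn_le_real.
apply: (@le_trans _ _ (k%:R ^+ 2 * zeta2 R k - 2 * k%:R * \sum_(1 <= d < k.+1) d%:R^-1)).
  by rewrite lerD2l lerN2 ler_wpM2l ?mulr_ge0 // harmonic_le.
rewrite /zeta2 !mulr_sumr -sumrB; apply: ler_sum_nat => d /andP[d0 _].
have := divn_le_real k d0; have := divn_ge_real k d0.
rewrite -expr_div_n -mulrA; have : 0 <= k%:R / d%:R :> R by rewrite divr_ge0.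
have : 0 <= (k %/ d)%:R :> R by [].
by move: (_ / _) ((k %/ d)%:R) => x y; nra.
Qed.

(** The quadratic terms cancel because [c * (pi^2 / 6) = 1 / 2], which dictates the value of
    [farey_density]. *)
Lemma err_sum_small (eps : R) : 0 < eps ->
  exists N, forall k, (N <= k)%N -> `|err_sum k| <= eps * k%:R ^+ 2.
Proof.
move=> e0.
(* Budget: [eps / 4] for [zeta2], [eps / 4] for the slope [eta], and [eps / 2] for the terms linear
   in [k]. *)
have e1 : 0 < eps / (4 * c) by rewrite divr_gt0 // mulr_gt0.
have [N1 h1] := zeta2_cvg e1.
pose eta := eps / (8 * c).
have eta0 : 0 < eta by rewrite divr_gt0 // mulr_gt0.
have [N2 h2] := nat_ge_ex ((2^-1 + 2 * c * eta^-1) * 2 / eps).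
exists (maxn N1 N2) => k; rewrite geq_max => /andP[/h1 {}h1 /h2 {}h2].
rewrite err_sumE; have := sum_divn_sqr_bounds k eta0 => /=.
move: (\sum_(_ <= _ < _) _) => S /andP[S1 S2].
have cpi : c * (pi ^+ 2 / 6) = 1 / 2.
  rewrite /farey_density; have := @pi_gt0 R; move: (@pi R) => p p0; field.
  by rewrite gt_eqF.
have -> : (k * k.+1)%N%:R / 2 = k%:R ^+ 2 * (c * (pi ^+ 2 / 6)) + k%:R / 2 :> R.
  by rewrite cpi natrM -natr1; field.
have k0 : 0 <= k%:R :> R by [].
move: (k%:R) k0 h2 S1 S2 => x x0 h2 S1 S2.
have h2' : (2^-1 + 2 * c * eta^-1) * 2 <= x * eps by rewrite -ler_pdivrMr.
have h1' : `|c * (pi ^+ 2 / 6 - zeta2 R k)| <= eps / 4.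
  rewrite normrM (gtr0_norm c_gt0) mulrC -ler_pdivlMr //.
  by apply: le_trans h1 _; rewrite invfM mulrA.
have ceta : c * eta = eps / 8.
  by rewrite /eta; field; rewrite gt_eqF.
move: h1'; rewrite ler_norml => /andP[h3 h4].
set Z := zeta2 R k in S1 S2 h3 h4 *; set P := pi ^+ 2 / 6 in cpi h3 h4 *.
have cS1 := ler_wpM2l (ltW c_gt0) S1; have cS2 := ler_wpM2l (ltW c_gt0) S2.
have x2 : 0 <= x ^+ 2 by rewrite exprn_ge0.
have m3 := ler_wpM2l x2 h3; have m4 := ler_wpM2l x2 h4.
have m2 := ler_wpM2l x0 h2'.
have y0 : 0 < eta^-1 by rewrite invr_gt0.
have e2 : c * (2 * x * (eta * x + eta^-1)) = eps / 4 * x ^+ 2 + 2 * c * eta^-1 * x.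
  rewrite (_ : _ * _ = 2 * (c * eta) * x ^+ 2 + 2 * c * eta^-1 * x); last by ring.
  by rewrite ceta; congr (_ + _); field.
have y1 : 0 <= c * eta^-1 * x by apply: mulr_ge0 => //; apply: mulr_ge0; exact: ltW.
rewrite mulrBr e2 in cS1.
rewrite ler_norml; apply/andP; split; nra.
Qed.

Lemma totient_err_rec k : (0 < k)%N ->
  totient_err k = err_sum k - \sum_(2 <= d < k.+1) totient_err (k %/ d).
Proof. by move=> k0; rewrite /err_sum big_ltn // divn1 addrK. Qed.

(* [totient_err_rec] expresses the error at [k] by the errors at [k %/ d], [d >= 2],
   whose weights sum to at most 3/4. *)
Lemma totient_err_contract (a : R) : 0 < a ->
  (exists N, forall k, (N <= k)%N -> `|totient_err k| <= a * k%:R ^+ 2) ->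
  exists N, forall k, (N <= k)%N -> `|totient_err k| <= (7 / 8 * a) * k%:R ^+ 2.
Proof.
move=> a0 [N0 h0].
have a16 : 0 < a / 16 by rewrite divr_gt0.
have [N1 h1] := err_sum_small a16.
(* [B] absorbs the arguments below [N0]. For large [k] the total is
   [1 / 16 + 3 / 4 + 1 / 16 = 7 / 8]. *)
pose B := (1 + c) * N0%:R ^+ 2.
have B0 : 0 <= B by rewrite mulr_ge0 ?exprn_ge0 // addr_ge0 // ltW.
have [N2 h2] := nat_ge_ex (B * 16 / a).
exists (maxn 1 (maxn N1 N2)) => k; rewrite !geq_max => /and3P[k0 /h1 {}h1 /h2 {}h2].
have he m : `|totient_err m| <= a * m%:R ^+ 2 + B.
  case: (leqP N0 m) => hm; first by apply: le_trans (h0 _ hm) _; rewrite lerDl.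
  apply: le_trans (totient_err_bound m) _; apply: ler_wpDl.
    by rewrite mulr_ge0 ?exprn_ge0 // ltW.
  apply: ler_wpM2l; first by rewrite addr_ge0 // ltW.
  by rewrite ler_pXn2r ?nnegrE // ler_nat ltnW.
have hs : `|\sum_(2 <= d < k.+1) totient_err (k %/ d)| <= 3 / 4 * a * k%:R ^+ 2 + B * k%:R.
  apply: le_trans (ler_norm_sum _ _ _) _.
  apply: (@le_trans _ _ (\sum_(2 <= d < k.+1) (a * k%:R ^+ 2 * d%:R ^- 2 + B))).
    apply: ler_sum_nat => d /andP[d0 _]; apply: le_trans (he _) _.
    have d1 : (0 < d)%N by apply: leq_trans d0.
    rewrite lerD2r -mulrA ler_wpM2l ?(ltW a0) // -expr_div_n.
    by rewrite ler_pXn2r ?nnegrE ?divr_ge0 // divn_le_real.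
  rewrite big_split /= -mulr_sumr sumr_const_nat; apply: lerD.
    rewrite mulrC -mulrA ler_wpM2r ?mulr_ge0 ?exprn_ge0 ?(ltW a0) //.
    exact: zeta2_tail_le.
  by rewrite -[B *+ _]mulr_natr ler_wpM2l // ler_nat; lia.
rewrite totient_err_rec //; apply: le_trans (ler_normB _ _) _.
have hB : B * k%:R <= a / 16 * k%:R ^+ 2.
  have : B * 16 <= k%:R * a by rewrite -ler_pdivrMr.
  have : 0 <= k%:R :> R by [].
  by move: (k%:R) => x; nra.
by move: (k%:R ^+ 2) h1 hs hB => x h1 hs hB; lra.
Qed.

(** The contraction is iterated from the trivial constant [1 + c]. *)
Lemma totient_sum_asymptotic (eps : R) : 0 < eps ->
  exists N, forall k, (N <= k)%N -> `|totient_err k| <= eps * k%:R ^+ 2.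
Proof.
move=> e0.
have iter n : exists N, forall k, (N <= k)%N ->
    `|totient_err k| <= ((7 / 8) ^+ n * (1 + c)) * k%:R ^+ 2.
  elim: n => [|n IH]; first by exists 0%N => k _; rewrite mul1r totient_err_bound.
  have a0 : 0 < (7 / 8) ^+ n * (1 + c).
    by rewrite mulr_gt0 ?exprn_gt0 ?addr_gt0 // divr_gt0.
  have [N hN] := totient_err_contract a0 IH.
  by exists N => k /hN; rewrite [(7 / 8) ^+ n.+1]exprS !mulrA.
have c1 : 0 < 1 + c by rewrite addr_gt0.
have [n hn] : exists n, (7 / 8) ^+ n * (1 + c) <= eps.
  have h78 : `|7 / 8 : R| < 1 by rewrite ger0_norm ?divr_ge0 //; lra.
  have /cvgrPdist_le /(_ (eps / (1 + c)) (divr_gt0 e0 c1)) [N _ hN] := cvg_expr h78.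
  exists N; have := hN N (leqnn N); rewrite /= sub0r normrN.
  rewrite ger0_norm ?exprn_ge0 ?divr_ge0 // ler_pdivlMr //.
have [N hN] := iter n; exists N => k /hN h; apply: le_trans h _.
by rewrite ler_wpM2r ?exprn_ge0.
Qed.

End TotientSum.

Theorem theorem8p1 (R : realType) :
  (fun k : nat => P0 R k.+1) @ \oo --> (3 / pi ^+ 2 : R).
Proof.
rewrite -[3 / _]/(farey_density R); have c_gt0 := farey_density_gt0 R.
apply/cvgrPdist_le => eps e0.
have e2 : 0 < eps / 2 by rewrite divr_gt0.
have [N1 h1] := totient_sum_asymptotic e2.
(* The denominator [k ^ 2 + k] in place of [k ^ 2] costs [c * k], at most [eps / 2 * k ^ 2] beyond
   [N2]. *)
have [N2 h2] := nat_ge_ex (farey_density R * 2 / eps).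
exists (maxn N1 N2) => // m /=; rewrite geq_max => /andP[/leqW/h1 {}h1 /leqW/h2 {}h2].
rewrite /P0 count_Nres_eq0 // -/(totient_sum m.+1).
move: h1 h2; rewrite /totient_err; set T := (totient_sum m.+1)%:R.
move: (farey_density R) c_gt0 => c c_gt0 h1 h2.
have -> : (m.+1 ^ 2 + m.+1)%N%:R = m.+1%:R ^+ 2 + m.+1%:R :> R by rewrite natrD natrX.
have x0 : 0 < m.+1%:R :> R by [].
move: (m.+1%:R) x0 h1 h2 => x x0 h1 h2.
have D0 : 0 < x ^+ 2 + x by rewrite addr_gt0 ?exprn_gt0.
have -> : c - T / (x ^+ 2 + x) = - (T - c * x ^+ 2 - c * x) / (x ^+ 2 + x).
  by field; rewrite gt_eqF.
rewrite normrM normrN normfV (gtr0_norm D0) ler_pdivrMr //.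
apply: le_trans (ler_normB _ _) _.
have -> : `|c * x| = c * x by rewrite ger0_norm // mulr_ge0 // ltW.
have h2' : c * 2 <= x * eps by rewrite -ler_pdivrMr.
nra.
Qed.
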